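(* Let $H_\varepsilon(z,\varphi)$ be a quasi-periodic Hamiltonian depending smoothly on a parameter $\varepsilon\in\mathbb{R}$, with evolution operator $\phi_{t,\varepsilon}$, and consider the fiberwise Hamiltonian deformation $$\Phi:(z,\boldsymbol t)\mapsto\big(\phi_{t,\varepsilon}(z,\varphi),\tau(\boldsymbol t)\big),\qquad \boldsymbol t=(t,\varepsilon,\varphi),\qquad \tau(\boldsymbol t)=\big(t,\varepsilon,R_t(\varphi)\big),\qquad R_t(\varphi)=\varphi+\hat\alpha t .$$ Then the components $\mathcal{M}^t\in\mathbb{R}$, $\mathcal{M}^\varepsilon\in\mathbb{R}$, $\mathcal{M}^\varphi\in\mathbb{R}^\ell$ of its moment map (corresponding to the parameters $t$, $\varepsilon$ and $\varphi$, with $\mathcal{M}^\varphi$ written as a row vector) are given by $$\mathcal{M}^t\big(\phi_{t,\varepsilon}(z,\varphi),\tau(\boldsymbol t)\big)=H_\varepsilon\big(\phi_{t,\varepsilon}(z,\varphi),R_t(\varphi)\big),$$ $$\mathcal{M}^\varepsilon\big(\phi_{t,\varepsilon}(z,\varphi),\tau(\boldsymbol t)\big)=\int_0^t\partial_\varepsilon H_\varepsilon\big(\phi_{s,\varepsilon}(z,\varphi),R_s(\varphi)\big)\,ds,$$ $$\mathcal{M}^\varphi\big(\phi_{t,\varepsilon}(z,\varphi),\tau(\boldsymbol t)\big)=\int_0^t\mathrm{D}_\varphi H_\varepsilon\big(\phi_{s,\varepsilon}(z,\varphi),R_s(\varphi)\big)\,ds.$$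
   Context: All maps are assumed sufficiently smooth. $\mathbb{T}^\ell=\mathbb{R}^\ell/\mathbb{Z}^\ell$; $U\subset\mathbb{R}^{2n}$ is open. $\mathrm{D}$, $\mathrm{D}_z$, $\mathrm{D}_\varphi$ denote (partial) Jacobian matrices, so the derivative of a scalar function is a row vector. In $\partial_\varepsilon H_\varepsilon$ and $\mathrm{D}_\varphi H_\varepsilon$ the derivative is the partial derivative of $(z,\varphi,\varepsilon)\mapsto H_\varepsilon(z,\varphi)$ evaluated at the indicated point. $a:U\to\mathbb{R}^{2n}$ is a smooth map such that $\Omega(z):=\mathrm{D}a(z)^\top-\mathrm{D}a(z)$ is invertible for every $z\in U$ ($\Omega$ represents an exact symplectic form on $U$). $\hat\alpha\in\mathbb{R}^\ell$ is fixed, $H_\varepsilon:U\times\mathbb{T}^\ell\to\mathbb{R}$, $X_{H_\varepsilon}(z,\varphi):=\Omega(z)^{-1}\mathrm{D}_zH_\varepsilon(z,\varphi)^\top$, and $\phi_{t,\varepsilon}(z,\varphi)\in U$ is the solution of $\frac{d}{dt}\phi_{t,\varepsilon}(z,\varphi)=X_{H_\varepsilon}\big(\phi_{t,\varepsilon}(z,\varphi),\varphi+\hat\alpha t\big)$, $\phi_{0,\varepsilon}(z,\varphi)=z$, on its maximal interval of existence. All formulas are for $(t,\varepsilon,z,\varphi)$ in the domain of definition of $\phi_{t,\varepsilon}(z,\varphi)$. The primitive function of the deformation is $$p_{t,\varepsilon}(z,\varphi)=\int_0^t\Big(a\big(\phi_{s,\varepsilon}(z,\varphi)\big)^\top X_{H_\varepsilon}\big(\phi_{s,\varepsilon}(z,\varphi),R_s(\varphi)\big)-H_\varepsilon\big(\phi_{s,\varepsilon}(z,\varphi),R_s(\varphi)\big)\Big)ds,$$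 which satisfies $\mathrm{D}_zp_{t,\varepsilon}(z,\varphi)=a(\phi_{t,\varepsilon}(z,\varphi))^\top\mathrm{D}_z\phi_{t,\varepsilon}(z,\varphi)-a(z)^\top$. In general, for a fiberwise Hamiltonian deformation $(z,\boldsymbol t)\mapsto(\phi_{\boldsymbol t}(z),\tau(\boldsymbol t))$ (a diffeomorphism with every $\phi_{\boldsymbol t}$ exact symplectic) with primitive function $p_{\boldsymbol t}(z)=p(z,\boldsymbol t)$, writing $\phi(z,\boldsymbol t)=\phi_{\boldsymbol t}(z)$, the generator is $\mathcal{F}_{\boldsymbol t}(z):=\mathrm{D}_{\boldsymbol t}\phi\big(\phi^{-1}_{\tau^{-1}(\boldsymbol t)}(z),\tau^{-1}(\boldsymbol t)\big)$ and the moment map $\mathcal{M}(z,\boldsymbol t)=\mathcal{M}_{\boldsymbol t}(z)$ is defined by $\mathcal{M}_{\boldsymbol t}(z)^\top:=a(z)^\top\mathcal{F}_{\boldsymbol t}(z)-\mathrm{D}_{\boldsymbol t}p\big(\phi^{-1}_{\tau^{-1}(\boldsymbol t)}(z),\tau^{-1}(\boldsymbol t)\big)$, where $\mathrm{D}_{\boldsymbol t}\phi$ and $\mathrm{D}_{\boldsymbol t}p$ are Jacobians with respect to the second argument. Equivalently, evaluated along the deformation, $$\mathcal{M}\big(\phi_{\boldsymbol t}(z),\tau(\boldsymbol t)\big)^\top=a\big(\phi_{\boldsymbol t}(z)\big)^\top\mathrm{D}_{\boldsymbol t}\phi_{\boldsymbol t}(z)-\mathrm{D}_{\boldsymbol t}p_{\boldsymbol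 t}(z).$$ Here $\phi_{\boldsymbol t}(z)=\phi_{t,\varepsilon}(z,\varphi)$ and $p_{\boldsymbol t}(z)=p_{t,\varepsilon}(z,\varphi)$ with $\boldsymbol t=(t,\varepsilon,\varphi)$. *)

(* Defs.v *)
From mathcomp Require Import all_boot all_order all_algebra.
From mathcomp Require Import all_classical all_reals all_analysis.

Set Implicit Arguments.
Unset Strict Implicit.
Unset Printing Implicit Defensive.

Import Order.TTheory GRing.Theory Num.Theory.
Import numFieldNormedType.Exports.

Local Open Scope classical_set_scope.
Local Open Scope ring_scope.

(* Points of R^m are column vectors, derivatives of scalar functions are rows.
   The library's 'J is stated for row vectors, with the transposed layout. *)
Definition jac (R : realType) (n m : nat) (f : 'cV[R]_n -> 'cV[R]_m)
    (x : 'cV[R]_n) : 'M[R]_(m, n) :=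
  \matrix_(i, j) ('D_(delta_mx j 0) f x) i 0.

Definition grad (R : realType) (n : nat) (f : 'cV[R]_n -> R)
    (x : 'cV[R]_n) : 'rV[R]_n :=
  \row_j 'D_(delta_mx j 0) f x.

(* Class C^k on D; this is meant for open D, since f is a total function. *)
Fixpoint Ck (R : realType) (E F : normedModType R) (k : nat) (D : set E)
    (f : E -> F) : Prop :=
  if k is k'.+1 then
    (forall x, D x -> differentiable f x) /\
    (forall v, Ck k' D (fun x => 'D_v f x))
  else forall x, D x -> {for x, continuous f}.

(* Oriented integral from 0 to t, also for t < 0. *)
Definition integral_from0 (R : realType) (t : R) (f : R -> R) : R :=
  if 0 <= t then \int[lebesgue_measure]_(s in `[0, t]) f s
  else - \int[lebesgue_measure]_(s in `[t, 0]) f s.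

Definition integral_from0_row (R : realType) (m : nat) (t : R)
    (f : R -> 'rV[R]_m) : 'rV[R]_m :=
  \row_j integral_from0 t (fun s => f s 0 j).

Definition Omega (R : realType) (n : nat)
    (a : 'cV[R]_(2 * n) -> 'cV[R]_(2 * n)) (z : 'cV[R]_(2 * n)) :
    'M[R]_(2 * n) :=
  (jac a z)^T - jac a z.

(* Functions on the torus R^l / Z^l are handled as functions on R^l that are
   invariant under Z^l. *)
Definition periodic_on (R : realType) (n l : nat) (U : set 'cV[R]_(2 * n))
    (H : R -> 'cV[R]_(2 * n) -> 'cV[R]_l -> R) : Prop :=
  forall eps z theta (k : 'cV[int]_l), U z ->
    H eps z (theta + map_mx intr k) = H eps z theta.

Definition torus_rot (R : realType) (l : nat) (alpha : 'cV[R]_l) (t : R)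
    (theta : 'cV[R]_l) : 'cV[R]_l :=
  theta + t *: alpha.

Definition XH (R : realType) (n l : nat)
    (a : 'cV[R]_(2 * n) -> 'cV[R]_(2 * n))
    (H : R -> 'cV[R]_(2 * n) -> 'cV[R]_l -> R)
    (eps : R) (z : 'cV[R]_(2 * n)) (theta : 'cV[R]_l) : 'cV[R]_(2 * n) :=
  invmx (Omega a z) *m (grad (fun w => H eps w theta) z)^T.

Definition solution_on (R : realType) (n l : nat) (U : set 'cV[R]_(2 * n))
    (X : 'cV[R]_(2 * n) -> 'cV[R]_l -> 'cV[R]_(2 * n)) (alpha : 'cV[R]_l)
    (theta : 'cV[R]_l) (z : 'cV[R]_(2 * n)) (I : set R)
    (x : R -> 'cV[R]_(2 * n)) : Prop :=
  [/\ is_interval I, open I, I 0, x 0 = z &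
      forall s, I s ->
        U (x s) /\ is_derive s 1 x (X (x s) (torus_rot alpha s theta))].

(* D is the domain of definition, in the variables (t, eps, z, theta). *)
Definition evolution_operator (R : realType) (n l : nat)
    (U : set 'cV[R]_(2 * n))
    (X : R -> 'cV[R]_(2 * n) -> 'cV[R]_l -> 'cV[R]_(2 * n))
    (alpha : 'cV[R]_l)
    (D : set (R * R * 'cV[R]_(2 * n) * 'cV[R]_l))
    (phi : R -> R -> 'cV[R]_(2 * n) -> 'cV[R]_l -> 'cV[R]_(2 * n)) : Prop :=
  (forall t eps z theta, D (t, eps, z, theta) -> U z) /\
  (forall eps z theta, U z ->
    let I := [set t | D (t, eps, z, theta)] in
    solution_on U (X eps) alpha theta z I (fun t => phi t eps z theta) /\
    (forall J x, solution_on U (X eps) alpha theta z J x -> J `<=` I)).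

Definition primitive (R : realType) (n l : nat)
    (a : 'cV[R]_(2 * n) -> 'cV[R]_(2 * n))
    (H : R -> 'cV[R]_(2 * n) -> 'cV[R]_l -> R) (alpha : 'cV[R]_l)
    (phi : R -> R -> 'cV[R]_(2 * n) -> 'cV[R]_l -> 'cV[R]_(2 * n))
    (t eps : R) (z : 'cV[R]_(2 * n)) (theta : 'cV[R]_l) : R :=
  integral_from0 t (fun s =>
    let w := phi s eps z theta in
    let theta_s := torus_rot alpha s theta in
    ((a w)^T *m XH a H eps w theta_s) 0 0 - H eps w theta_s).

(* A deformation with q real parameters: [phi z bt] is its fibre map,
   defined for (z, bt) in D, [tau] its action on the parameters (a bijection
   of R^q) and [p] its primitive function. [fibre_inv] is the inverse of
   [phi ^~ bt] on the set of z at which it is defined. *)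
Definition fibre_inv (R : realType) (n q : nat)
    (D : set ('cV[R]_(2 * n) * 'cV[R]_q))
    (phi : 'cV[R]_(2 * n) -> 'cV[R]_q -> 'cV[R]_(2 * n))
    (bt : 'cV[R]_q) : 'cV[R]_(2 * n) -> 'cV[R]_(2 * n) :=
  'pinv_(fun=> 0) [set z | D (z, bt)] (phi ^~ bt).

Definition param_inv (R : realType) (q : nat) (tau : 'cV[R]_q -> 'cV[R]_q) :
    'cV[R]_q -> 'cV[R]_q :=
  'pinv_(fun=> 0) setT tau.

Definition deformation_generator (R : realType) (n q : nat)
    (D : set ('cV[R]_(2 * n) * 'cV[R]_q))
    (phi : 'cV[R]_(2 * n) -> 'cV[R]_q -> 'cV[R]_(2 * n))
    (tau : 'cV[R]_q -> 'cV[R]_q)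
    (z : 'cV[R]_(2 * n)) (bt : 'cV[R]_q) : 'M[R]_(2 * n, q) :=
  let bs := param_inv tau bt in
  jac (phi (fibre_inv D phi bs z)) bs.

Definition moment_map (R : realType) (n q : nat)
    (a : 'cV[R]_(2 * n) -> 'cV[R]_(2 * n))
    (D : set ('cV[R]_(2 * n) * 'cV[R]_q))
    (phi : 'cV[R]_(2 * n) -> 'cV[R]_q -> 'cV[R]_(2 * n))
    (tau : 'cV[R]_q -> 'cV[R]_q)
    (p : 'cV[R]_(2 * n) -> 'cV[R]_q -> R)
    (z : 'cV[R]_(2 * n)) (bt : 'cV[R]_q) : 'cV[R]_q :=
  let bs := param_inv tau bt in
  ((a z)^T *m deformation_generator D phi tau z bt
    - grad (p (fibre_inv D phi bs z)) bs)^T.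

Definition par (R : realType) (l : nat) (t eps : R) (theta : 'cV[R]_l) :
    'cV[R]_(1 + 1 + l) :=
  col_mx (col_mx t%:M eps%:M) theta.

Definition par_t (R : realType) (l : nat) (bt : 'cV[R]_(1 + 1 + l)) : R :=
  (usubmx (usubmx bt)) 0 0.

Definition par_eps (R : realType) (l : nat) (bt : 'cV[R]_(1 + 1 + l)) : R :=
  (dsubmx (usubmx bt)) 0 0.

Definition par_theta (R : realType) (l : nat) (bt : 'cV[R]_(1 + 1 + l)) :
    'cV[R]_l :=
  dsubmx bt.

Definition tau_rot (R : realType) (l : nat) (alpha : 'cV[R]_l)
    (bt : 'cV[R]_(1 + 1 + l)) : 'cV[R]_(1 + 1 + l) :=
  par (par_t bt) (par_eps bt) (torus_rot alpha (par_t bt) (par_theta bt)).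

(* A function of (t, eps, z, theta) as a function of (z, bt). *)
Definition with_par (R : realType) (n l : nat) (A : Type)
    (f : R -> R -> 'cV[R]_(2 * n) -> 'cV[R]_l -> A)
    (z : 'cV[R]_(2 * n)) (bt : 'cV[R]_(1 + 1 + l)) : A :=
  f (par_t bt) (par_eps bt) z (par_theta bt).

Definition evolution_moment_map (R : realType) (n l : nat)
    (a : 'cV[R]_(2 * n) -> 'cV[R]_(2 * n))
    (H : R -> 'cV[R]_(2 * n) -> 'cV[R]_l -> R) (alpha : 'cV[R]_l)
    (D : set (R * R * 'cV[R]_(2 * n) * 'cV[R]_l))
    (phi : R -> R -> 'cV[R]_(2 * n) -> 'cV[R]_l -> 'cV[R]_(2 * n)) :
    'cV[R]_(2 * n) -> 'cV[R]_(1 + 1 + l) -> 'cV[R]_(1 + 1 + l) :=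
  moment_map a
    [set x | D (par_t x.2, par_eps x.2, x.1, par_theta x.2)]
    (with_par phi) (tau_rot alpha) (with_par (primitive a H alpha phi)).

(* Main.v *)
Require Import Defs.
From mathcomp Require Import all_boot all_order all_algebra.
From mathcomp Require Import all_classical all_reals all_analysis.
From mathcomp Require Import ring lra.

Set Implicit Arguments.
Unset Strict Implicit.
Unset Printing Implicit Defensive.

Import Order.TTheory GRing.Theory Num.Theory.
Import numFieldNormedType.Exports.

Local Open Scope classical_set_scope.
Local Open Scope ring_scope.

(** The moment map along the deformation is [a(phi) . D phi - D p], where D is the
    derivative in the parameters; everything is a computation of [D p].

    In the direction of time, [p] is the integral of [a(phi) . X - H] along the
    orbit and [phi' = X], so that the fundamental theorem of calculus leaves [H].

    In a direction [(c, d)] of the space of the parameters [(eps, theta)], let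
    [r] be the parameter on the line through [(eps, theta)], let [u s r] be the
    orbit for the parameter [r], and let [v = d u / d r] at [r = 0]. The claim is
      d p / d r = a(u) . v - int_0^t k,
    where [k] is the derivative of the Hamiltonian in the direction [(c, d)] at
    a fixed point of phase space. Differentiating both sides in time gives it
    formally: the terms in the Jacobian of [a] combine to [v] paired with
    [Omega X], and [Omega X] is the gradient of [H] ([moment_identity]).

    That computation exchanges the derivatives in [s] and [r] of [u], which is
    only of class C^1. The exchange is avoided by differentiating in time not
    the r-derivative but the finite quantity
      defect s r = p s r - a(u s 0) . (u s r - u s 0) + r * int_0^s k,
    in whose time derivative no second derivative of [u] occurs. If the
    increment from [0] to [r] of this time derivative is o(r) uniformly on the
    segment from [0] to [t], the mean value inequality makes the increment of
    [defect] itself o(r), which is the claim. Locally the o(r) is a limit of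
    difference quotients as [(s, r)] tends to [(s0, 0)]; such limits are
    computed by the chain rule for strictly differentiable functions, and C^1
    functions are strictly differentiable ([strict_derivative_cvg]).
    Compactness of the segment makes the bound uniform
    ([quotient_antiderivative_cvg0]).

    The definition of the moment map involves the inverse of the fibre map at
    fixed parameters. It is a left inverse because two solutions that meet at
    time [t] already agree at time [0]: the Hamiltonian vector field is locally
    Lipschitz ([locally_lipschitz_XH]), so solutions are unique
    ([solution_unique]). *)

(** * Strict differentiability of C^1 functions *)

Lemma cvg_near_eq {T : Type} {U : topologicalType} (F : set_system T) {FF : Filter F}
    (f g : T -> U) (l : U) :
  (\forall x \near F, f x = g x) -> g @ F --> l -> f @ F --> l.
Proof.
move=> fg; apply: cvg_trans; apply: near_eq_cvg.
by apply: filterS fg => x ->.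
Qed.

Lemma cvg_sum {R : realType} {T : Type} (F : set_system T) {FF : Filter F}
    (J : finType) (f : J -> T -> R) (l : J -> R) :
  (forall j, f j @ F --> l j) -> (fun t => \sum_j f j t) @ F --> \sum_j l j.
Proof.
move=> fl; rewrite (_ : (fun t => _) = \sum_j f j); last first.
  by apply/funext => t; rewrite fct_sumE.
elim/big_ind2 : _ => //; first exact: cvg_cst.
by move=> g a h b ga hb; exact: cvgD.
Qed.

(** The order of [a] and [b] is left free, so that forward and backward times
    are treated at once. *)
Lemma mean_value_interval {R : realType} (I : set R) (f df : R -> R) (a b : R) :
  is_interval I -> (forall x, I x -> is_derive x 1 f (df x)) ->
  I a -> I b -> exists2 c, I c & f b - f a = df c * (b - a).
Proof.
move=> Iitv dfI; wlog ab : a b / a <= b => [wlg Ia Ib|Ia Ib].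
  have [ab|/ltW ba] := leP a b; first exact: wlg.
  by have [c Ic E] := wlg b a ba Ib Ia; exists c; rewrite // -opprB E -mulrN opprB.
have abI x : x \in `[a, b] -> I x.
  by rewrite in_itv/= => xab; exact: Iitv xab.
have [c /abI Ic E] : exists2 c, c \in `[a, b] & f b - f a = df c * (b - a).
  apply: MVT_segment => //.
    by move=> x /subset_itv_oo_cc /abI /dfI.
  apply: derivable_within_continuous => x /abI Ix.
  by have [] := dfI _ Ix.
by exists c.
Qed.

(** Class C^1 is stated through directional derivatives, one direction at a time.
    Continuity of the differential in operator norm follows when finitely many
    directions span the space, with bounded coordinates; the bound 1 holds for
    the sup norms of columns and of products, and is stable under products. *)
Definition finite_coords {R : realType} (E : normedModType R) : Prop :=
  exists (J : finType) (b : J -> E) (c : J -> E -> R),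
    forall x, x = \sum_j c j x *: b j /\ forall j, `|c j x| <= `|x|.

Lemma finite_coords_line {R : realType} : finite_coords R.
Proof.
exists unit, (fun=> 1), (fun _ x => x) => x; split=> //.
by rewrite big_const cardT enumT unlock /= addr0 [_ *: _]mulr1.
Qed.

Lemma finite_coords_col {R : realType} m : finite_coords 'cV[R]_m.
Proof.
exists 'I_m, (fun j => delta_mx j 0), (fun j (x : 'cV[R]_m) => x j 0) => x; split.
  rewrite [LHS]matrix_sum_delta; apply: eq_bigr => i _.
  by rewrite big_ord1.
move=> j; rewrite [leRHS]/Num.Def.normr/= mx_normrE.
exact: (le_bigmax _ _ (j, ord0)).
Qed.

Lemma finite_coords_prod {R : realType} (E F : normedModType R) :
  finite_coords E -> finite_coords F -> finite_coords (E * F)%type.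
Proof.
move=> [J [b [c H]]] [K [d [e G]]].
exists (J + K)%type, (fun k => match k with inl j => (b j, 0) | inr k => (0, d k) end),
  (fun k x => match k with inl j => c j x.1 | inr k => e k x.2 end) => -[x y].
split; last first.
  move=> [j|k]; rewrite prod_normE /= le_max.
    by rewrite (H x).2.
  by rewrite (G y).2 orbT.
rewrite big_sumType /=.
have [Hx _] := H x; have [Gy _] := G y.
have -> : \sum_i c i x *: (b i, 0 : F) = (\sum_i c i x *: b i, 0).
  rewrite (_ : (_, 0) = (fun z : E => (z, 0 : F)) (\sum_i c i x *: b i))//.
  apply: (big_ind2 (fun u (v : E) => u = (v, 0 : F))) => //.
    by move=> ? ? ? ? -> ->; congr pair; rewrite /= ?addr0.
  by move=> i _; congr pair; rewrite /= scaler0.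
have -> : \sum_i e i y *: (0 : E, d i) = (0, \sum_i e i y *: d i).
  apply: (big_ind2 (fun u (v : F) => u = (0 : E, v))) => //.
    by move=> ? ? ? ? -> ->; congr pair; rewrite /= ?addr0.
  by move=> i _; congr pair; rewrite /= scaler0.
by rewrite -Hx -Gy; congr pair; rewrite /= ?addr0 ?add0r.
Qed.

Lemma is_derive_line {R : realType} (E : normedModType R) (f : E -> R) x v (s : R) :
  differentiable f (x + s *: v) ->
  is_derive s 1 (fun s => f (x + s *: v)) ('D_v f (x + s *: v)).
Proof.
move=> df.
have E1 : (fun h : R => h^-1 *: (((fun s : R => f (x + s *: v)) \o shift s) (h *: (1 : R))
    - f (x + s *: v))) =
   (fun h : R => h^-1 *: ((f \o shift (x + s *: v)) (h *: v) - f (x + s *: v))).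
  apply/funext => h /=; rewrite [_ *: 1]mulr1 scalerDl.
  by rewrite addrCA.
have : derivable f (x + s *: v) v by apply: diff_derivable.
by move=> dv; split; rewrite /derivable /derive E1.
Qed.

(** By the mean value theorem on the segment from [x] to [y], the increment is the
    derivative in the direction [y - x] at a point of the segment. Expanded in
    coordinates, it differs from the derivative at [x0] by the oscillation of
    finitely many continuous functions. *)
Lemma strict_derivative {R : realType} (E : normedModType R) (D : set E) (f : E -> R) x0 :
  finite_coords E -> open D -> Ck 1 D f -> D x0 ->
  forall e, 0 < e ->
    \forall x \near x0 & y \near x0, `|f y - f x - 'D_(y - x) f x0| <= e * `|y - x|.
Proof.
move=> [J [b [c H]]] Do [df Cf] Dx0 e e0.
have E1 x v : D x -> 'D_v f x = \sum_j c j v * 'D_(b j) f x.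
  move=> Dx; rewrite deriveE; last exact: df.
  rewrite [in LHS](H v).1 linear_sum/=; apply: eq_bigr => j _.
  by rewrite linearZ/= deriveE//; exact: df.
pose N := (#|J|.+1%:R : R).
have N0 : 0 < N by rewrite /N ltr0n.
have : \forall x \near x0, D x /\ forall j, `|'D_(b j) f x0 - 'D_(b j) f x| <= e / N.
  near=> x; split.
    by near: x; exact: open_nbhs_nbhs.
  near: x; apply: filter_forall => j.
  have /cvgrPdist_le : 'D_(b j) f @ x0 --> 'D_(b j) f x0 by exact: Cf.
  by apply; rewrite divr_gt0.
move=> /nbhs_ballP [d /= d0 dP].
have BD x : ball x0 d x -> D x by move/dP => [].
exists (ball x0 d, ball x0 d); first by split; exact: nbhsx_ballx.
move=> [x y] [/= xB yB].
pose I := `[0, 1]%classic : set R.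
have seg s : I s -> ball x0 d (x + s *: (y - x)).
  rewrite /I /= in_itv/= => /andP[s0 s1].
  rewrite -!ball_normE/= in xB yB *.
  have -> : x0 - (x + s *: (y - x)) = (1 - s) *: (x0 - x) + s *: (x0 - y).
    have -> : y - x = (x0 - x) - (x0 - y).
      by rewrite opprB [RHS]addrC subrKA.
    rewrite opprD addrA; move: (x0 - x) (x0 - y) => A B.
    by rewrite scalerBr opprB scalerBl scale1r addrA addrAC.
  rewrite (le_lt_trans (ler_normD _ _))// !normrZ.
  rewrite (ger0_norm s0) ger0_norm ?subr_ge0//.
  have mlt : Num.max `|x0 - x| `|x0 - y| < d by rewrite gt_max xB yB.
  apply: le_lt_trans mlt; set m := Num.max _ _.
  rewrite [leRHS](_ : m = (1 - s) * m + s * m); last by ring.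
  rewrite lerD//.
    by rewrite ler_wpM2l ?subr_ge0// le_max lexx.
  by rewrite ler_wpM2l// le_max lexx orbT.
have [s /seg sB] : exists2 s, I s & f (x + 1 *: (y - x)) - f (x + 0 *: (y - x)) =
    'D_(y - x) f (x + s *: (y - x)) * (1 - 0).
  apply: (@mean_value_interval _ I (fun s => f (x + s *: (y - x)))
     (fun s => 'D_(y - x) f (x + s *: (y - x)))).
  - exact: interval_is_interval.
  - by move=> s /seg /BD Ds; apply: is_derive_line; exact: df.
  - by rewrite /I /= in_itv/= lexx ler01.
  - by rewrite /I /= in_itv/= lexx ler01.
rewrite scale1r scale0r addr0 subr0 mulr1 subrKC => ->.
rewrite !E1//; last exact: BD.
rewrite -sumrB (le_trans (ler_norm_sum _ _ _))//.
have : \sum_j `|c j (y - x) * 'D_(b j) f (x + s *: (y - x)) - c j (y - x) * 'D_(b j) f x0|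
   <= \sum_(j : J) `|y - x| * (e / N).
  apply: ler_sum => j _; rewrite -mulrBr normrM ler_pM ?(H (y - x)).2//.
  by rewrite distrC; exact: (dP _ sB).2.
move=> /le_trans; apply.
rewrite sumr_const -mulr_natl.
rewrite [leLHS](_ : _ = (#|J|%:R / N) * (e * `|y - x|)); last by ring.
rewrite ler_piMl ?mulr_ge0 ?(ltW e0)// ler_pdivrMr// mul1r /N.
by rewrite ler_nat.
Unshelve. all: by end_near. Qed.

(** The chain rule in the form used throughout: both endpoints of the increment
    may move, and the filter is arbitrary. Unlike the pointwise chain rule, it
    yields limits that are joint in time and in the deformation parameter. *)
Lemma strict_derivative_cvg {R : realType} (E : normedModType R) (D : set E)
    (f : E -> R) x0 {T : Type} (F : set_system T) {FF : Filter F}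
    (p q : T -> E) (r : T -> R) (w : E) :
  finite_coords E -> open D -> Ck 1 D f -> D x0 ->
  p @ F --> x0 -> q @ F --> x0 ->
  (fun t => (r t)^-1 *: (q t - p t)) @ F --> w ->
  (fun t => (r t)^-1 * (f (q t) - f (p t))) @ F --> 'D_w f x0.
Proof.
move=> Ef Do Cf Dx0 px qx rw.
have df := Cf.1 _ Dx0.
have dD t : 'D_(q t - p t) f x0 = 'd f x0 (q t - p t) by rewrite deriveE.
have lincvg : (fun t => 'd f x0 ((r t)^-1 *: (q t - p t))) @ F --> 'D_w f x0.
  rewrite deriveE//; have := @diff_continuous _ _ _ _ f df w.
  exact: cvg_comp.
suff rem : (fun t => (r t)^-1 * (f (q t) - f (p t)) - 'd f x0 ((r t)^-1 *: (q t - p t))) @ F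
    --> (0 : R).
  rewrite -['D_w f x0]add0r.
  rewrite (_ : (fun t => _) = (fun t => ((r t)^-1 * (f (q t) - f (p t))
      - 'd f x0 ((r t)^-1 *: (q t - p t))) + 'd f x0 ((r t)^-1 *: (q t - p t)))).
    exact: cvgD.
  by apply/funext => t; rewrite subrK.
apply/cvgr0Pnorm_le => e e0.
pose e' := e / (`|w| + 1).
have e'0 : 0 < e' by rewrite divr_gt0// ltr_wpDl.
have wb : \forall t \near F, `|(r t)^-1 *: (q t - p t)| <= `|w| + 1.
  have /cvgrPdist_le /(_ _ ltr01) := rw; apply: filterS => t H.
  rewrite -[X in `|X|](subrK w) addrC (le_trans (ler_normD _ _))// lerD2l.
  by rewrite distrC.
have st : \forall t \near F, `|f (q t) - f (p t) - 'D_(q t - p t) f x0| <= e' * `|q t - p t|.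
  have [[A B] /= [nA nB] AB] := strict_derivative Ef Do Cf Dx0 e'0.
  have pA : \forall t \near F, A (p t) := px _ nA.
  have qB : \forall t \near F, B (q t) := qx _ nB.
  by apply: filterS2 pA qB => t At Bt; exact: (AB (p t, q t)).
near=> t.
rewrite linearZ/= -mulrBr normrM -dD.
apply: (@le_trans _ _ (e' * `|(r t)^-1 *: (q t - p t)|)).
  rewrite normrZ mulrCA ler_wpM2l//; near: t; exact: st.
have -> : e = e' * (`|w| + 1) by rewrite /e' divfK// gt_eqF// ltr_wpDl.
rewrite ler_wpM2l ?(ltW e'0)//; near: t; exact: wb.
Unshelve. all: by end_near. Qed.

Lemma cvg_coordinates {R : realType} m n {T : Type} (F : set_system T) {FF : Filter F}
    (M : T -> 'M[R]_(m, n)) (M0 : 'M[R]_(m, n)) :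
  (forall i j, (fun t => M t i j) @ F --> M0 i j) -> M @ F --> M0.
Proof.
move=> H; apply/cvgrPdist_le => e e0; near=> t.
rewrite /Num.Def.normr/= mx_normrE (bigmax_le _ (ltW e0))//= => ij _.
rewrite !mxE; move: ij; near: t; apply: filter_forall => -[i j] /=.
by have /cvgrPdist_le := H i j; apply.
Unshelve. all: by end_near. Qed.

Lemma derive_coord {R : realType} (E : normedModType R) m n (f : E -> 'M[R]_(m, n)) x v i j :
  derivable f x v -> 'D_v (fun y => f y i j) x = ('D_v f x) i j.
Proof. by move=> dfx; rewrite derive_mx// mxE. Qed.

Lemma C1_coord {R : realType} (E : normedModType R) (D : set E) m n
    (f : E -> 'M[R]_(m, n)) i j :
  open D -> Ck 1 D f -> Ck 1 D (fun x => f x i j).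
Proof.
move=> Do [df Cf]; split => [x Dx|v x Dx].
  exact: (@differentiable_comp _ _ _ _ f (fun M => M i j) x (df _ Dx) (differentiable_coord _ _ _)).
have gh y : D y -> 'D_v (fun y => f y i j) y = ('D_v f y) i j.
  by move=> Dy; rewrite derive_coord//; apply/diff_derivable/df.
suff : 'D_v (fun y => f y i j) @ x --> ('D_v f x) i j by rewrite -gh.
apply: (@cvg_near_eq _ _ _ _ _ (fun y => ('D_v f y) i j)).
  near=> y; rewrite gh//.
  by near: y; exact: open_nbhs_nbhs.
have cD : 'D_v f @ x --> 'D_v f x := Cf v x Dx.
exact: (cvg_comp _ (fun M : 'M[R]_(m, n) => M i j) cD (@coord_continuous _ _ _ i j _)).
Unshelve. all: by end_near. Qed.

(** * Oriented integrals and their dependence on a parameter *)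

Lemma open_interval_enlarge {R : realType} (I : set R) (s : R) :
  open I -> I s -> (exists2 b, I b & b < s) /\ (exists2 u, I u & s < u).
Proof.
move=> Io Is; have /nbhs_ballP [d /= d0 dI] : nbhs s I by exact: open_nbhs_nbhs.
have d2 : 0 < d / 2 by rewrite divr_gt0.
have d2d : d / 2 < d by rewrite ltr_pdivrMr// ltr_pMr// ltr1n.
split; [exists (s - d / 2); [|lra]|exists (s + d / 2); [|lra]].
- by apply: dI; rewrite -ball_normE/= opprB addrC subrK gtr0_norm.
- by apply: dI; rewrite -ball_normE/= opprD addNKr normrN gtr0_norm.
Qed.

(** Both branches of the oriented integral equal the difference of two integrals
    from a common base point [b] of [I], chosen below [0] and [s]. This also covers
    [s = 0], where the two branches meet. *)
Lemma is_derive_integral_from0 {R : realType} (I : set R) (f : R -> R) (s : R) :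
  is_interval I -> open I -> I 0 -> (forall x, I x -> {for x, continuous f}) ->
  I s -> is_derive s 1 (fun x => integral_from0 x f) (f s).
Proof.
move=> Ii Io I0 cf Is.
have minI : I (Num.min 0 s) by case: (leP 0 s).
have maxI : I (Num.max 0 s) by case: (leP 0 s).
have [[b Ib]] := open_interval_enlarge Io minI.
rewrite lt_min => /andP[b0 bs] _.
have [_ [u Iu]] := open_interval_enlarge Io maxI.
rewrite gt_max => /andP[u0 us].
have fint : lebesgue_measure.-integrable `[b, u] (EFin \o f).
  apply: continuous_compact_integrable; first exact: segment_compact.
  apply: continuous_in_subspaceT => x; rewrite inE/= in_itv/= => xbu.
  by apply: cf; exact: Ii xbu.
have sub x y : b <= x -> y <= u -> lebesgue_measure.-integrable `[x, y] (EFin \o f).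
  move=> bx yu; apply: integrableS fint => //.
  by apply: subset_itv; rewrite bnd_simp.
have E x : x \in `]b, u[ -> integral_from0 x f =
   \int[lebesgue_measure]_(y in `[b, x]) f y - \int[lebesgue_measure]_(y in `[b, 0]) f y.
  rewrite in_itv/= => /andP[bx xu]; rewrite /integral_from0; case: ifPn => [x0|].
    rewrite (@Rintegral_itvB _ f (BLeft b) (BRight x) 0) ?bnd_simp ?(ltW b0)//.
      rewrite Rintegral_itv_obnd_cbnd//.
      by apply: integrableS (sub 0 x (ltW b0) (ltW xu)) => //; exact: subset_itv_oc_cc.
    exact: sub (ltW xu).
  rewrite -ltNge => x0.
  rewrite -[RHS]opprB (@Rintegral_itvB _ f (BLeft b) (BRight 0) x) ?bnd_simp ?(ltW bx) ?(ltW x0)//.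
    rewrite Rintegral_itv_obnd_cbnd//.
    by apply: integrableS (sub x 0 (ltW bx) (ltW u0)) => //; exact: subset_itv_oc_cc.
  exact: sub (ltW u0).
have [dF F'] : derivable (fun x => \int[lebesgue_measure]_(y in `[b, x]) f y) s 1 /\
    derive1 (fun x => \int[lebesgue_measure]_(y in `[b, x]) f y) s = f s.
  exact: (continuous_FTC1_closed us fint bs (cf _ Is)).
apply: (@near_eq_is_derive _ _ _ (fun x => \int[lebesgue_measure]_(y in `[b, x]) f y
   - \int[lebesgue_measure]_(y in `[b, 0]) f y)).
- near=> x; rewrite E//; near: x.
  by apply: near_in_itvoo; rewrite in_itv/= bs us.
- have : is_derive s 1 (fun x => \int[lebesgue_measure]_(y in `[b, x]) f y) (f s).
    by split; [exact: dF|rewrite -derive1E; exact: F'].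
  move=> H; rewrite -[f s]subr0; apply: is_deriveB.
Unshelve. all: by end_near. Qed.

Lemma integral_from0_0 {R : realType} (f : R -> R) : integral_from0 0 f = 0.
Proof. by rewrite /integral_from0 lexx set_itv1 Rintegral_set1. Qed.

(** Differentiation under the integral sign, in a form adapted to a C^1 flow:
    [G] is the time derivative of [F], and the increment of [G] in the parameter
    is o(r) locally uniformly in time. Compactness makes this uniform on [J], and
    the mean value theorem transfers it to [F]. *)
Lemma quotient_antiderivative_cvg0 {R : realType} (J : set R) (F G : R -> R -> R) (t : R) :
  is_interval J -> compact J -> J 0 -> J t ->
  (\forall r \near 0, F 0 r = 0) ->
  (\forall r \near 0, forall s, J s -> is_derive s 1 (F^~ r) (G s r)) ->
  (forall s0, J s0 -> (fun x : R * R => x.2^-1 * (G x.1 x.2 - G x.1 0))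
       @ filter_prod (nbhs s0) 0^' --> (0 : R)) ->
  (fun r => r^-1 * (F t r - F t 0)) @ 0^' --> (0 : R).
Proof.
move=> Ji Jc J0 Jt F0 dF H.
apply/cvgr0Pnorm_le => e e0.
pose e' := e / (`|t| + 1).
have t1 : 0 < `|t| + 1 by rewrite ltr_wpDl.
have e'0 : 0 < e' by rewrite divr_gt0.
have U : \forall r \near 0^', J `<=` (fun s => `|r^-1 * (G s r - G s 0)| <= e').
  have cov := (compact_near_coveringP J).1 Jc.
  apply: (cov R 0^' (fun r s => `|r^-1 * (G s r - G s 0)| <= e')) => s0 Js0.
  by have /cvgr0Pnorm_le /(_ _ e'0) := H _ Js0.
have dF0 := nbhs_singleton dF.
have F00 := nbhs_singleton F0.
near=> r.
have dFr : forall s, J s -> is_derive s 1 (F^~ r) (G s r).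
  by near: r; exact: nbhs_dnbhs.
have F0r : F 0 r = 0 by near: r; exact: nbhs_dnbhs.
have Ur : J `<=` (fun s => `|r^-1 * (G s r - G s 0)| <= e') by near: r.
have [c Jc' E] : exists2 c, J c &
    (F t r - F t 0) - (F 0 r - F 0 0) = (G c r - G c 0) * (t - 0).
  apply: (@mean_value_interval _ J (fun s => F s r - F s 0) (fun s => G s r - G s 0)) => //.
  move=> s Js; have ? := dFr _ Js; have ? := dF0 _ Js; exact: is_deriveB.
move: E; rewrite F0r F00 !subr0 => ->.
rewrite mulrA normrM (@le_trans _ _ (e' * `|t|))// ?ler_wpM2r ?Ur//.
rewrite (_ : e = e' * (`|t| + 1)) ?ler_wpM2l ?(ltW e'0)// ?lerDl//.
by rewrite divfK// gt_eqF.
Unshelve. all: by end_near. Qed.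

(** * Uniqueness of solutions of Lipschitz equations *)

Lemma ler_norm_coord {R : realType} m n (M : 'M[R]_(m, n)) i j : `|M i j| <= `|M|.
Proof.
rewrite [leRHS]/Num.Def.normr/= mx_normrE.
exact: (le_bigmax _ (fun x : 'I_m * 'I_n => `|M x.1 x.2|) (i, j)).
Qed.

Lemma norm_mx_le {R : realType} m n (M : 'M[R]_(m, n)) e :
  0 <= e -> (forall i j, `|M i j| <= e) -> `|M| <= e.
Proof.
move=> e0 H; rewrite /Num.Def.normr/= mx_normrE.
by apply: bigmax_le => // -[i j] _; exact: H.
Qed.

Lemma norm_mulmx_le {R : realType} m n p (A : 'M[R]_(m, n)) (B : 'M[R]_(n, p)) :
  `|A *m B| <= n%:R * `|A| * `|B|.
Proof.
apply: norm_mx_le => [|i j]; first by rewrite !mulr_ge0.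
rewrite mxE (le_trans (ler_norm_sum _ _ _))//.
rewrite -mulrA mulr_natl -[X in _ *+ X]card_ord -sumr_const.
by apply: ler_sum => k _; rewrite normrM ler_pM// ler_norm_coord.
Qed.

(** On a segment of radius [h] with [K * h <= 1 / 2], let [c] be a point where
    [`|u|] is maximal. The mean value theorem bounds each coordinate of [u c] by
    half of that maximum, which is therefore zero. *)
Lemma near_zero_of_derivative_le {R : realType} m (I : set R) (u du : R -> 'cV[R]_m) s0 :
  open I -> (forall s, I s -> is_derive s 1 u (du s)) -> I s0 -> u s0 = 0 ->
  (exists K, \forall s \near s0, `|du s| <= K * `|u s|) ->
  \forall s \near s0, u s = 0.
Proof.
move=> Io dI Is0 us0 [K0 HK0].
pose K := `|K0| + 1.
have K0' : 0 < K by rewrite ltr_wpDl.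
have : \forall s \near s0, I s /\ `|du s| <= K * `|u s|.
  near=> s; split; first by near: s; exact: open_nbhs_nbhs.
  have : `|du s| <= K0 * `|u s| by near: s.
  move=> /le_trans; apply; rewrite ler_wpM2r// /K.
  by rewrite (le_trans (ler_norm _))// lerDl.
move=> /nbhs_ballP [d /= d0 dP].
pose h := Num.min (d / 2) (2 * K)^-1.
have h0 : 0 < h by rewrite lt_min divr_gt0// invr_gt0 mulr_gt0.
pose J := `[s0 - h, s0 + h]%classic.
have Jd s : J s -> `|s - s0| <= h.
  by rewrite /J /= in_itv/= ler_distl.
have JI s : J s -> ball s0 d s.
  move=> /Jd sh; rewrite -ball_normE/= distrC (le_lt_trans sh)//.
  by rewrite gt_min ltr_pdivrMr// ltr_pMr// ltr1n.
have Js0 : J s0 by rewrite /J /= in_itv/= gerBl lerDl (ltW h0).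
have [c] : exists2 c, c \in `[s0 - h, s0 + h] &
    forall t, t \in `[s0 - h, s0 + h] -> `|u t| <= `|u c|.
  apply: EVT_max; first by rewrite lerBlDr -addrA lerDl addr_ge0 ?ltW.
  apply: continuous_in_subspaceT => x; rewrite inE/= => /JI /dP [/dI Ix _].
  apply: (@continuous_comp _ _ _ u (fun v => `|v|)); last exact: norm_continuous.
  apply: differentiable_continuous.
  by apply/derivable1_diffP; case: Ix.
move=> cJ cmax.
have uc0 : `|u c| <= 2^-1 * `|u c|.
  apply: norm_mx_le => [|i j]; first by rewrite mulr_ge0.
  rewrite (ord1 j).
  have [x Jx E] : exists2 x, J x & u c i 0 - u s0 i 0 = du x i 0 * (c - s0).
    apply: (@mean_value_interval _ J (fun s => u s i 0) (fun s => du s i 0)) => //.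
      exact: interval_is_interval.
    move=> s /JI /dP [/dI [du1 <-] _]; split; last exact: derive_coord.
    by move/derivable_mxP : du1; exact.
  move: E; rewrite us0 mxE subr0 => ->.
  rewrite normrM.
  have /JI /dP [_ dux] := Jx.
  rewrite (@le_trans _ _ ((K * `|u c|) * h))//.
    rewrite ler_pM ?Jd// (le_trans (ler_norm_coord _ _ _))// (le_trans dux)//.
    by rewrite ler_wpM2l ?(ltW K0')// cmax.
  rewrite mulrAC ler_wpM2r//.
  rewrite (@le_trans _ _ (K * (2 * K)^-1))// ?ler_wpM2l ?(ltW K0')// ?ge_min ?lexx ?orbT//.
  by rewrite invfM mulrCA divff ?gt_eqF// mulr1.
have {}uc0 : `|u c| <= 0 by lra.
apply/nbhs_ballP; exists h => //= s; rewrite -ball_normE/= => /ltW sh.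
apply/eqP; rewrite -normr_le0 (le_trans _ uc0)// cmax// in_itv/=.
by rewrite -ler_distl distrC.
Unshelve. all: by end_near. Qed.

(** The zero set of [u] is closed in [I] by continuity, and open by the local
    statement; [I] is connected. *)
Lemma zero_of_derivative_le {R : realType} m (I : set R) (u du : R -> 'cV[R]_m) s1 :
  is_interval I -> open I -> (forall s, I s -> is_derive s 1 u (du s)) ->
  (forall s0, I s0 -> u s0 = 0 -> exists K, \forall s \near s0, `|du s| <= K * `|u s|) ->
  I s1 -> u s1 = 0 -> forall s, I s -> u s = 0.
Proof.
move=> Ii Io dI HK Is1 us1.
have /connected_intervalP Ic := Ii.
pose B := I `&` [set s | u s = 0].
suff BI : B = I by move=> s; rewrite -BI => -[].
apply: Ic; first by exists s1.
- exists B; last by rewrite /B setIA setIid.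
  rewrite openE => s [Is us].
  have := near_zero_of_derivative_le Io dI Is us (HK _ Is us).
  have : \forall s \near s, I s by exact: open_nbhs_nbhs.
  by apply: filterS2.
- exists (closure B); first exact: closed_closure.
  apply/seteqP; split => s; first by move=> Bs; split; [exact: Bs.1|exact: subset_closure].
  move=> [Is cBs]; split=> //=.
  have cu : {for s, continuous u}.
    by apply/differentiable_continuous/derivable1_diffP; case: (dI _ Is).
  apply/eqP; rewrite -normr_le0; apply/ler_addgt0Pl => e e0; rewrite addr0.
  have /cvgrPdist_le /(_ _ e0) ne := cu.
  by have [r [[_ /= ->]]] := cBs _ ne; rewrite subr0.
Qed.

Definition locally_lipschitz {R : realType} (E F : normedModType R) (f : E -> F) (x0 : E) :=
  exists L, \forall x \near x0 & y \near x0, `|f y - f x| <= L * `|y - x|.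

Lemma C1_locally_lipschitz {R : realType} (E : normedModType R) (D : set E) (f : E -> R) x0 :
  finite_coords E -> open D -> Ck 1 D f -> D x0 -> locally_lipschitz f x0.
Proof.
move=> Ef Do Cf Dx0.
have df := Cf.1 _ Dx0.
have [k k0 kP] := linear_lipschitz (@diff_continuous _ _ _ _ f df).
exists (k + 1).
have [[A B] /= nAB AB] := strict_derivative Ef Do Cf Dx0 (@ltr01 R).
exists (A, B) => //= -[x y] /AB /=; rewrite mul1r deriveE// => H.
rewrite -[X in `|X|](subrK ('d f x0 (y - x))) (le_trans (ler_normD _ _))//.
by rewrite addrC mulrDl mul1r lerD.
Qed.

Lemma locally_lipschitz_mx {R : realType} (E : normedModType R) m n (f : E -> 'M[R]_(m, n)) x0 :
  (forall i j, locally_lipschitz (fun x => f x i j) x0) -> locally_lipschitz f x0.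
Proof.
move=> H.
have {H} /choice [L HL] : forall ij : 'I_m * 'I_n, exists L, \forall x \near x0 & y \near x0,
   `|f y ij.1 ij.2 - f x ij.1 ij.2| <= L * `|y - x|.
  by move=> ij; exact: H.
exists (\sum_ij `|L ij|).
have : filter_prod (nbhs x0) (nbhs x0) (fun xy => forall ij,
  `|f xy.2 ij.1 ij.2 - f xy.1 ij.1 ij.2| <= L ij * `|xy.2 - xy.1|).
  have FF : Filter (filter_prod (nbhs x0) (nbhs x0)) by exact: filter_prod_filter.
  exact: (@filter_forall _ _ (fun ij xy =>
    `|f xy.2 ij.1 ij.2 - f xy.1 ij.1 ij.2| <= L ij * `|xy.2 - xy.1|) _ FF HL).
apply: filterS => -[x y] /= Hxy.
apply: norm_mx_le => [|i j]; first by rewrite mulr_ge0// sumr_ge0.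
rewrite !mxE (le_trans (Hxy (i, j)))// ler_wpM2r//.
by rewrite (le_trans (ler_norm _))// (bigD1 (i, j))//= lerDl sumr_ge0.
Qed.

Lemma locally_lipschitzB {R : realType} (E F : normedModType R) (f g : E -> F) x0 :
  locally_lipschitz f x0 -> locally_lipschitz g x0 ->
  locally_lipschitz (fun x => f x - g x) x0.
Proof.
move=> [K HK] [L HL]; exists (K + L).
apply: filterS2 HK HL => -[x y] /= Hf Hg.
have -> : f y - g y - (f x - g x) = (f y - f x) - (g y - g x).
  by rewrite !opprB (addrC (g x)) addrACA (addrC (- g y)).
by rewrite (le_trans (ler_normB _ _))// mulrDl lerD.
Qed.

Lemma cvg_triple {T : Type} {A B C : topologicalType} (F : set_system T) {FF : Filter F}
    (f : T -> A) (g : T -> B) (h : T -> C) (x : A) (y : B) (z : C) :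
  f @ F --> x -> g @ F --> y -> h @ F --> z ->
  (fun t => (f t, g t, h t)) @ F --> (x, y, z).
Proof. by move=> fx gy hz; exact: cvg_pair (cvg_pair fx gy) hz. Qed.

Lemma continuous_locally_lipschitz {R : realType} (E F : normedModType R) (f : E -> F) x0 :
  locally_lipschitz f x0 -> {for x0, continuous f}.
Proof.
move=> [L [[A B] /= [nA nB] AB]]; apply/cvgrPdist_le => e e0.
have L0 : 0 < `|L| + 1 by rewrite ltr_wpDl.
near=> y; rewrite distrC (@le_trans _ _ (L * `|y - x0|))//.
  apply: (AB (x0, y)); split => /=; first exact: nbhs_singleton.
  by near: y.
rewrite (@le_trans _ _ ((`|L| + 1) * `|y - x0|)) ?ler_wpM2r//.
  by rewrite (le_trans (ler_norm _))// lerDl.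
rewrite mulrC -ler_pdivlMr// distrC; near: y.
have e1 : 0 < e / (`|L| + 1) by rewrite divr_gt0.
by have /cvgrPdist_le /(_ _ e1) := @cvg_id _ (nbhs x0).
Unshelve. all: by end_near. Qed.

(** The inverse matrices are bounded near [x0]: writing
    [M x0 *m w = M x *m w + (M x0 - M x) *m w], the last term is absorbed in the
    left-hand side as soon as [M x] is close to [M x0]. *)
Lemma near_mulmx_bounded_below {R : realType} (E : normedModType R) m (M : E -> 'M[R]_m) x0 :
  {for x0, continuous M} -> M x0 \in unitmx ->
  exists C, \forall x \near x0, forall w : 'cV[R]_m, `|w| <= C * `|M x *m w|.
Proof.
move=> cM M0; pose C := m%:R * `|invmx (M x0)|.
have C0 : 0 <= C by rewrite mulr_ge0.
exists (2 * C).
pose d := (2 * (C * m%:R + 1))^-1.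
have d0 : 0 < d by rewrite invr_gt0 mulr_gt0// ltr_wpDl// mulr_ge0.
near=> x; move=> w.
have Mx : `|M x0 - M x| <= d.
  near: x; by have /cvgrPdist_le /(_ _ d0) := cM.
have w1 : `|w| <= C * `|M x0 *m w|.
  by rewrite -[X in `|X|](mulKmx M0) norm_mulmx_le.
have w2 : `|M x0 *m w| <= `|M x *m w| + m%:R * d * `|w|.
  rewrite -[X in `|X *m w|](subrK (M x)) mulmxDl addrC (le_trans (ler_normD _ _))// lerD2l.
  rewrite (le_trans (norm_mulmx_le _ _))// ler_wpM2r// ler_wpM2l//.
have : C * m%:R * d <= 2^-1.
  rewrite /d invfM mulrCA ler_piMr// ler_pdivrMr ?mul1r ?lerDl//.
  by rewrite ltr_wpDl// mulr_ge0.
move=> Cd.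
have w3 : C * `|M x0 *m w| <= C * `|M x *m w| + 2^-1 * `|w|.
  rewrite (le_trans (ler_wpM2l C0 w2))// mulrDr lerD2l mulrA mulrA ler_wpM2r//.
by lra.
Unshelve. all: by end_near. Qed.

(** The difference of two solutions satisfies
    [M y *m (v y - v x) = (g y - g x) - (M y - M x) *m v x], where [v x] is bounded
    and [M y] is bounded below. This bounds the increment of [invmx (M x) *m g x]
    by those of [M] and [g]. *)
Lemma locally_lipschitz_linear_solution {R : realType} (E : normedModType R) m
    (M : E -> 'M[R]_m) (g v : E -> 'cV[R]_m) x0 :
  locally_lipschitz M x0 -> locally_lipschitz g x0 -> M x0 \in unitmx ->
  (\forall x \near x0, M x *m v x = g x) -> locally_lipschitz v x0.
Proof.
move=> LM Lg M0 Mv.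
have cM := continuous_locally_lipschitz LM.
have cg := continuous_locally_lipschitz Lg.
have [C' HC'] := near_mulmx_bounded_below cM M0.
pose C := `|C'|.
have HC : \forall x \near x0, forall w : 'cV[R]_m, `|w| <= C * `|M x *m w|.
  apply: filterS HC' => x H w; rewrite (le_trans (H w))// ler_wpM2r//.
  exact: ler_norm.
have C0 : 0 <= C by rewrite normr_ge0.
have vb : \forall x \near x0, `|v x| <= C * (`|g x0| + 1).
  near=> x.
  have Hx : forall w : 'cV[R]_m, `|w| <= C * `|M x *m w| by near: x.
  have Mx : M x *m v x = g x by near: x.
  rewrite (le_trans (Hx _))// Mx ler_wpM2l//.
  rewrite -[X in `|X| <= _](subrK (g x0)) addrC (le_trans (ler_normD _ _))// lerD2l distrC.
  near: x; by have /cvgrPdist_le /(_ _ ltr01) := cg.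
have [K HK] := LM; have [L HL] := Lg.
exists (C * (L + m%:R * K * (C * (`|g x0| + 1)))).
have H1 : \forall x \near x0, [/\ forall w : 'cV[R]_m, `|w| <= C * `|M x *m w|,
    M x *m v x = g x & `|v x| <= C * (`|g x0| + 1)].
  by near=> x; split; near: x.
have H2 : \forall x \near x0 & y \near x0, [/\ forall w : 'cV[R]_m, `|w| <= C * `|M x *m w|,
    M x *m v x = g x & `|v x| <= C * (`|g x0| + 1)] /\
    [/\ forall w : 'cV[R]_m, `|w| <= C * `|M y *m w|,
    M y *m v y = g y & `|v y| <= C * (`|g x0| + 1)].
  exists ([set x | [/\ forall w : 'cV[R]_m, `|w| <= C * `|M x *m w|,
    M x *m v x = g x & `|v x| <= C * (`|g x0| + 1)]],
   [set x | [/\ forall w : 'cV[R]_m, `|w| <= C * `|M x *m w|,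
    M x *m v x = g x & `|v x| <= C * (`|g x0| + 1)]]) => //.
apply: filterS3 HK HL H2 => -[x y] /= Kxy Lxy [[_ Mx vx] [Hy My vy]].
rewrite (le_trans (Hy _))// -mulrA ler_wpM2l//.
have -> : M y *m (v y - v x) = (g y - g x) - (M y - M x) *m v x.
  by rewrite mulmxBr mulmxBl My Mx opprB addrA subrK.
rewrite (le_trans (ler_normB _ _))// mulrDl lerD//.
rewrite (le_trans (norm_mulmx_le _ _))// -!mulrA ler_wpM2l//.
rewrite (@le_trans _ _ ((K * `|y - x|) * (C * (`|g x0| + 1))))//.
  by rewrite ler_pM.
by rewrite le_eqVlt; apply/orP; left; apply/eqP; ring.
Unshelve. all: by end_near. Qed.

(** * The Hamiltonian vector field *)

Section hamiltonian_vector_field.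
Context {R : realType} {n l : nat} (U : set 'cV[R]_(2 * n)).
Context (a : 'cV[R]_(2 * n) -> 'cV[R]_(2 * n)).
Context (H : R -> 'cV[R]_(2 * n) -> 'cV[R]_l -> R).
Hypothesis U_open : open U.
Hypothesis a_C2 : Ck 2 U a.
Hypothesis Omega_unit : forall z, U z -> Omega a z \in unitmx.

(** The Hamiltonian as a function on a single normed space, to which the notion of
    class C^k applies. *)
Definition uncurry_ham (x : R * 'cV[R]_(2 * n) * 'cV[R]_l) : R := H x.1.1 x.1.2 x.2.

Definition ham_domain : set (R * 'cV[R]_(2 * n) * 'cV[R]_l) := [set x | U x.1.2].

Hypothesis H_C2 : Ck 2 ham_domain uncurry_ham.

Lemma continuous_ham_z : continuous (fun x : R * 'cV[R]_(2 * n) * 'cV[R]_l => x.1.2).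
Proof.
move=> x; have c1 : fst @ x --> x.1 by exact: cvg_fst.
have c2 : snd @ x.1 --> x.1.2 by exact: cvg_snd.
exact: (cvg_comp _ _ c1 c2).
Qed.

Lemma open_ham_domain : open ham_domain.
Proof.
apply: (@open_comp _ _ (fun x : R * 'cV[R]_(2 * n) * 'cV[R]_l => x.1.2)) => // x _.
exact: continuous_ham_z.
Qed.

Lemma ham_coords : finite_coords (R * 'cV[R]_(2 * n) * 'cV[R]_l)%type.
Proof.
apply: (@finite_coords_prod _ (R * 'cV[R]_(2 * n))%type 'cV[R]_l);
  last exact: finite_coords_col.
apply: (@finite_coords_prod _ R 'cV[R]_(2 * n)); last exact: finite_coords_col.
exact: finite_coords_line.
Qed.

Lemma derive_ham_z (v w : 'cV[R]_(2 * n)) eps (th : 'cV[R]_l) :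
  'D_v (fun w => H eps w th) w = 'D_(0, v, 0) uncurry_ham (eps, w, th).
Proof.
have E : (fun h : R => h^-1 *: (((fun w => H eps w th) \o shift w) (h *: v) - H eps w th)) =
    (fun h => h^-1 *: ((uncurry_ham \o shift (eps, w, th)) (h *: (0, v, 0))
      - uncurry_ham (eps, w, th))).
  by apply/funext => h; rewrite /uncurry_ham /= !scaler0 !add0r.
by rewrite /derive E.
Qed.

Lemma locally_lipschitz_Omega z : U z -> locally_lipschitz (Omega a) z.
Proof.
move=> Uz.
have C1 v i : Ck 1 U (fun z => ('D_v a z) i 0) by apply: C1_coord; [exact: U_open|exact: a_C2.2].
have L i j : locally_lipschitz (fun z => jac a z i j) z.
  rewrite (_ : (fun _ => _) = (fun z => ('D_(delta_mx j 0) a z) i 0)).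
    by apply: (C1_locally_lipschitz (@finite_coords_col R (2 * n)) U_open (C1 _ _)).
  by apply/funext => y; rewrite mxE.
apply: locally_lipschitz_mx => i j.
rewrite (_ : (fun _ => _) = (fun z => jac a z j i - jac a z i j)).
  exact: locally_lipschitzB.
by apply/funext => y; rewrite !mxE.
Qed.

Lemma locally_lipschitz_grad_ham x : ham_domain x ->
  locally_lipschitz (fun x : R * 'cV[R]_(2 * n) * 'cV[R]_l =>
    (grad (fun w => H x.1.1 w x.2) x.1.2)^T) x.
Proof.
move=> Ux; apply: locally_lipschitz_mx => i j.
rewrite (_ : (fun _ => _) = 'D_(0, delta_mx i 0, 0) uncurry_ham).
  exact: (C1_locally_lipschitz ham_coords open_ham_domain (H_C2.2 _)).
by apply/funext => -[[e w] th]; rewrite !mxE derive_ham_z.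
Qed.

Lemma Omega_XH eps z th : U z ->
  Omega a z *m XH a H eps z th = (grad (fun w => H eps w th) z)^T.
Proof. by move=> Uz; rewrite mulKVmx// Omega_unit. Qed.

(** [XH] is the solution of a linear system with C^1 coefficients, of matrix [Omega]
    and right-hand side the gradient of [H]. *)
Lemma locally_lipschitz_XH x : ham_domain x ->
  locally_lipschitz (fun x : R * 'cV[R]_(2 * n) * 'cV[R]_l => XH a H x.1.1 x.1.2 x.2) x.
Proof.
move=> Ux; apply: (@locally_lipschitz_linear_solution _ _ _ (fun x => Omega a x.1.2)
  (fun x => (grad (fun w => H x.1.1 w x.2) x.1.2)^T)).
- have [L [[A B] /= [nA nB] AB]] := locally_lipschitz_Omega Ux.
  exists `|L|.
  have pr := @continuous_ham_z x.
  exists ((fun x => A x.1.2), (fun x => B x.1.2)); first by split; [exact: pr nA|exact: pr nB].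
  move=> [p q] [/= Ap Bq]; rewrite (le_trans (AB (p.1.2, q.1.2) _))//=.
  rewrite (@le_trans _ _ (`|L| * `|q.1.2 - p.1.2|))// ?ler_wpM2r ?ler_norm//.
  by rewrite ler_wpM2l// !prod_normE/= !le_max lexx orbT.
- exact: locally_lipschitz_grad_ham.
- exact: Omega_unit.
- near=> y; rewrite Omega_XH//; near: y.
  by apply: open_nbhs_nbhs; split => //; exact: open_ham_domain.
Unshelve. all: by end_near. Qed.

Lemma solution_unique alpha eps (th : 'cV[R]_l) (I : set R) (x y : R -> 'cV[R]_(2 * n)) s1 :
  is_interval I -> open I ->
  (forall s, I s -> U (x s) /\ is_derive s 1 x (XH a H eps (x s) (torus_rot alpha s th))) ->
  (forall s, I s -> U (y s) /\ is_derive s 1 y (XH a H eps (y s) (torus_rot alpha s th))) ->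
  I s1 -> x s1 = y s1 -> forall s, I s -> x s = y s.
Proof.
move=> Ii Io xsol ysol Is1 xy1 s Is; apply/eqP; rewrite -subr_eq0; apply/eqP.
have cont (u : R -> 'cV[R]_(2 * n)) (r : R) d : is_derive r 1 u d -> u @ r --> u r.
  by move=> [du _]; apply/differentiable_continuous/derivable1_diffP.
move: s Is; apply: (@zero_of_derivative_le _ _ I (fun s => x s - y s)
  (fun s => XH a H eps (x s) (torus_rot alpha s th) - XH a H eps (y s) (torus_rot alpha s th)) s1)
   => //; last by rewrite xy1 subrr.
- move=> s Is; have [_ ?] := xsol _ Is; have [_ ?] := ysol _ Is; exact: is_deriveB.
move=> s0 Is0 /eqP; rewrite subr_eq0 => /eqP xy0.
have [Ux dx] := xsol _ Is0; have [_ dy] := ysol _ Is0.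
have ct : (fun s => torus_rot alpha s th) @ s0 --> torus_rot alpha s0 th.
  have cs : (fun s : R => s *: alpha) @ s0 --> s0 *: alpha by exact: scalel_continuous.
  exact: (cvgD (cvg_cst th) cs).
have cx : (fun s => (eps, x s, torus_rot alpha s th)) @ s0 --> (eps, x s0, torus_rot alpha s0 th).
  exact: (cvg_triple (cvg_cst eps) (cont _ _ _ dx) ct).
have cy : (fun s => (eps, y s, torus_rot alpha s th)) @ s0 --> (eps, x s0, torus_rot alpha s0 th).
  by rewrite xy0; exact: (cvg_triple (cvg_cst eps) (cont _ _ _ dy) ct).
have [L [[A B] /= [nA nB] AB]] :=
  @locally_lipschitz_XH (eps, x s0, torus_rot alpha s0 th) Ux.
exists L.
have yA : \forall s \near s0, A (eps, y s, torus_rot alpha s th) := cy _ nA.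
have xB : \forall s \near s0, B (eps, x s, torus_rot alpha s th) := cx _ nB.
apply: filterS2 yA xB => s As Bs.
have := AB ((eps, y s, torus_rot alpha s th), (eps, x s, torus_rot alpha s th)) (conj As Bs).
move=> /le_trans; apply.
rewrite [X in L * X <= _](_ : _ = `|x s - y s|)//.
rewrite !prod_normE /= !subrr !normr0.
by rewrite (max_r (normr_ge0 _)) (max_l (normr_ge0 _)).
Qed.

End hamiltonian_vector_field.

(** * Orbits and their primitive function *)

Lemma is_derive_C1_comp {R : realType} (E : normedModType R) (D : set E) (f : E -> R)
    (g : R -> E) (s : R) (dg : E) :
  finite_coords E -> open D -> Ck 1 D f -> D (g s) -> is_derive s 1 g dg ->
  is_derive s 1 (fun s => f (g s)) ('D_dg f (g s)).
Proof.
move=> Ef Do Cf Dg [gs gE].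
have cg : g @ s --> g s by apply/differentiable_continuous/derivable1_diffP.
have shift_s : (fun h : R => h *: (1 : R) + s) @ 0^' --> s.
  have c0 : (fun h : R => h *: (1 : R)) @ (0 : R) --> (0 : R) *: (1 : R).
    exact: scalel_continuous.
  have cD : (fun h : R => h *: (1 : R) + s) @ (0 : R) --> (0 : R) *: (1 : R) + s.
    exact: (cvgD c0 (cvg_cst s)).
  rewrite scale0r add0r in cD.
  exact: cvg_within_filter cD.
have lim : (fun h : R => h^-1 * (f (g (h *: (1 : R) + s)) - f (g s))) @ 0^' --> 'D_dg f (g s).
  apply: (@strict_derivative_cvg _ _ D f (g s) _ 0^' _ (fun=> g s)
      (fun h : R => g (h *: (1 : R) + s)) id dg) => //.
  - exact: cvg_cst.
  - exact: (cvg_comp _ _ shift_s cg).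
  - by rewrite -gE; exact: gs.
split; first by apply/cvg_ex; exists ('D_dg f (g s)).
exact/cvg_lim.
Qed.

Lemma difference_quotient_split {R : realType} m (r : R) (ar a0 Xr X0 ur u0 b : 'I_m -> R)
    (Nr N0 k : R) : r != 0 ->
  r^-1 * ((\sum_i ar i * Xr i - Nr
      - \sum_i (b i * (ur i - u0 i) + a0 i * (Xr i - X0 i)) + r * k)
    - (\sum_i a0 i * X0 i - N0)) =
  \sum_i (r^-1 * (ar i - a0 i)) * Xr i - r^-1 * (Nr - N0)
    - \sum_i b i * (r^-1 * (ur i - u0 i)) + k.
Proof.
move=> r0.
have -> : \sum_i b i * (r^-1 * (ur i - u0 i)) = r^-1 * \sum_i b i * (ur i - u0 i).
  by rewrite mulr_sumr; apply: eq_bigr => i _; rewrite mulrCA.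
have -> : \sum_i (r^-1 * (ar i - a0 i)) * Xr i =
    r^-1 * (\sum_i ar i * Xr i - \sum_i a0 i * X0 i - \sum_i a0 i * (Xr i - X0 i)).
  by rewrite -!sumrB mulr_sumr; apply: eq_bigr => i _; ring.
rewrite big_split /=.
by field.
Qed.

Section evolution.
Context {R : realType} {n l : nat} (U : set 'cV[R]_(2 * n)).
Context (a : 'cV[R]_(2 * n) -> 'cV[R]_(2 * n)) (alpha : 'cV[R]_l).
Context (H : R -> 'cV[R]_(2 * n) -> 'cV[R]_l -> R).
Context (D : set (R * R * 'cV[R]_(2 * n) * 'cV[R]_l)).
Context (phi : R -> R -> 'cV[R]_(2 * n) -> 'cV[R]_l -> 'cV[R]_(2 * n)).
Hypothesis U_open : open U.
Hypothesis a_C2 : Ck 2 U a.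
Hypothesis Omega_unit : forall z, U z -> Omega a z \in unitmx.
Hypothesis H_C2 : Ck 2 (ham_domain U) (uncurry_ham H).
Hypothesis phi_evol : evolution_operator U (XH a H) alpha D phi.
Hypothesis D_open : open D.
Hypothesis phi_C1 : Ck 1 D (fun x => phi x.1.1.1 x.1.1.2 x.1.2 x.2).

Lemma a_coord_C1 i : Ck 1 U (fun w => a w i 0).
Proof.
apply: C1_coord => //; split; first exact: a_C2.1.
by move=> v x Ux; apply: differentiable_continuous; exact: (a_C2.2 v).1.
Qed.

Lemma ham_C1 : Ck 1 (ham_domain U) (uncurry_ham H).
Proof.
split; first exact: H_C2.1.
by move=> v x Ux; apply: differentiable_continuous; exact: (H_C2.2 v).1.
Qed.

Lemma derive_jac v w : U w -> 'D_v a w = jac a w *m v.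
Proof.
move=> Uw; have da : differentiable a w by exact: a_C2.1.
rewrite deriveE// {1}(matrix_sum_delta v) linear_sum; apply/colP => i.
rewrite summxE mxE; apply: eq_bigr => j _.
rewrite big_ord1 linearZ mxE mulrC; congr (_ * _).
by rewrite mxE deriveE.
Qed.

Section orbit.
Context (e : R) (z : 'cV[R]_(2 * n)) (th : 'cV[R]_l).
Hypothesis Uz : U z.
Let I := [set s | D (s, e, z, th)].
Let u s := phi s e z th.
Let X s := XH a H e (u s) (torus_rot alpha s th).

Lemma orbit_interval : is_interval I.
Proof. by have [[]] := phi_evol.2 e z th Uz. Qed.

Lemma orbit_open : open I.
Proof. by have [[]] := phi_evol.2 e z th Uz. Qed.

Lemma orbit_domain0 : I 0.
Proof. by have [[]] := phi_evol.2 e z th Uz. Qed.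

Lemma orbit0 : u 0 = z.
Proof. by have [[]] := phi_evol.2 e z th Uz. Qed.

Lemma orbit_mem s : I s -> U (u s).
Proof. by move=> Is; have [[_ _ _ _ /(_ s Is) []]] := phi_evol.2 e z th Uz. Qed.

Lemma is_derive_orbit s : I s -> is_derive s 1 u (X s).
Proof. by move=> Is; have [[_ _ _ _ /(_ s Is) []]] := phi_evol.2 e z th Uz. Qed.

Lemma cvg_torus_rot (s : R) : (fun s => torus_rot alpha s th) @ s --> torus_rot alpha s th.
Proof.
have cs : (fun s : R => s *: alpha) @ s --> s *: alpha by exact: scalel_continuous.
exact: (cvgD (cvg_cst th) cs).
Qed.

Lemma cvg_orbit (s : R) : I s -> u @ s --> u s.
Proof.
move=> Is; have [du _] := is_derive_orbit Is.
by apply/differentiable_continuous/derivable1_diffP.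
Qed.

Lemma cvg_orbit_phase (s : R) : I s ->
  (fun s => (e, u s, torus_rot alpha s th)) @ s --> (e, u s, torus_rot alpha s th).
Proof.
move=> Is; exact: (cvg_triple (cvg_cst e) (cvg_orbit Is) (@cvg_torus_rot s)).
Qed.

Lemma cvg_orbit_X (s : R) : I s -> X @ s --> X s.
Proof.
move=> Is.
have Up : ham_domain U (e, u s, torus_rot alpha s th) by exact: orbit_mem.
have cX := continuous_locally_lipschitz
  (locally_lipschitz_XH U_open a_C2 Omega_unit H_C2 Up).
exact: (cvg_comp _ _ (cvg_orbit_phase Is) cX).
Qed.

Lemma cvg_orbit_ham (f : R * 'cV[R]_(2 * n) * 'cV[R]_l -> R) (s : R) : I s ->
  (forall x, ham_domain U x -> {for x, continuous f}) ->
  (fun s => f (e, u s, torus_rot alpha s th)) @ s --> f (e, u s, torus_rot alpha s th).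
Proof.
move=> Is cf; have Up : ham_domain U (e, u s, torus_rot alpha s th) by exact: orbit_mem.
exact: (cvg_comp _ _ (cvg_orbit_phase Is) (cf _ Up)).
Qed.

Lemma cvg_orbit_a (s : R) i : I s -> (fun s => a (u s) i 0) @ s --> a (u s) i 0.
Proof.
move=> Is.
have ca : (fun w => a w i 0) @ u s --> a (u s) i 0.
  by apply: differentiable_continuous; apply: (a_coord_C1 i).1; exact: orbit_mem.
exact: (cvg_comp _ _ (cvg_orbit Is) ca).
Qed.

(** The integrand of the primitive function, that is, the action form along the
    orbit. *)
Definition lagrangian s := ((a (u s))^T *m X s) 0 0 - H e (u s) (torus_rot alpha s th).

Lemma lagrangianE s : lagrangian s =
  \sum_i a (u s) i 0 * X s i 0 - H e (u s) (torus_rot alpha s th).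
Proof.
by rewrite /lagrangian mxE; congr (_ - _); apply: eq_bigr => i _; rewrite mxE.
Qed.

Lemma is_derive_primitive s : I s ->
  is_derive s 1 (fun s => primitive a H alpha phi s e z th) (lagrangian s).
Proof.
move=> Is; apply: (is_derive_integral_from0 orbit_interval orbit_open orbit_domain0 _ Is).
move=> {Is}s Is.
suff : lagrangian @ s --> lagrangian s by [].
have -> : lagrangian = (fun s => \sum_i a (u s) i 0 * X s i 0
   - H e (u s) (torus_rot alpha s th)).
  by apply/funext => r; exact: lagrangianE.
apply: cvgB.
  apply: cvg_sum => i; apply: cvgM; first exact: cvg_orbit_a.
  exact: (cvg_comp _ _ (cvg_orbit_X Is) (@coord_continuous _ _ _ i 0 _)).
apply: (@cvg_orbit_ham (uncurry_ham H)) => // x Ux.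
by apply: differentiable_continuous; exact: H_C2.1.
Qed.

Lemma primitive0 : primitive a H alpha phi 0 e z th = 0.
Proof. exact: integral_from0_0. Qed.

End orbit.

(** The algebraic heart: the left-hand side is the antisymmetrised Jacobian of [a]
    paired with [v] and [X], that is, [Omega X] paired with [v], and [Omega X] is
    the gradient of [H]. *)
Lemma moment_identity e w th v : U w ->
  let X := XH a H e w th in
  \sum_i ('D_v a w) i 0 * X i 0 - \sum_i (jac a w *m X) i 0 * v i 0
    = 'D_v (fun w => H e w th) w.
Proof.
move=> Uw X.
have dH : differentiable (uncurry_ham H) (e, w, th) by exact: H_C2.1.
have -> : 'D_v (fun w => H e w th) w = (grad (fun w => H e w th) w *m v) 0 0.
  rewrite derive_ham_z deriveE// mxE.
  have -> : ((0, v, 0) : R * 'cV[R]_(2 * n) * 'cV[R]_l) =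
      \sum_j v j 0 *: (0, delta_mx j 0, 0).
    rewrite [in LHS](matrix_sum_delta v).
    rewrite (_ : (0, _, 0) = (fun x : 'cV[R]_(2 * n) => (0 : R, x, 0 : 'cV[R]_l))
      (\sum_i \sum_j v i j *: delta_mx i j))//.
    apply: (big_ind2 (fun x (y : R * 'cV[R]_(2 * n) * 'cV[R]_l) =>
      (0 : R, x, 0 : 'cV[R]_l) = y)) => //.
      by move=> ? ? ? ? <- <-; congr (_, _, _); rewrite /= ?addr0.
    by move=> i _; rewrite big_ord1; congr (_, _, _); rewrite /= ?scaler0.
  rewrite linear_sum; apply: eq_bigr => j _.
  by rewrite linearZ/= mulrC mxE derive_ham_z deriveE.
have -> : grad (fun w => H e w th) w = X^T *m (Omega a w)^T.
  by rewrite -trmx_mul (Omega_XH H Omega_unit)// trmxK.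
rewrite derive_jac// /Omega linearB/= trmxK mulmxBr mulmxBl [RHS]mxE.
congr (_ + _).
  rewrite -mulmxA [RHS]mxE; apply: eq_bigr => i _.
  by rewrite mulrC; congr (_ * _); rewrite [RHS]mxE.
rewrite [RHS]mxE -trmx_mul [in RHS]mxE; congr (- _).
by apply: eq_bigr => i _; congr (_ * _); rewrite [RHS]mxE.
Qed.

(** * Variation of the primitive function with the parameters *)

Section variation.
Context (eps c : R) (z : 'cV[R]_(2 * n)) (theta d : 'cV[R]_l).
Hypothesis Uz : U z.
Let e r := r * c + eps.
Let th r := r *: d + theta.
Let u s r := phi s (e r) z (th r).
Let X s r := XH a H (e r) (u s r) (torus_rot alpha s (th r)).
Let p s r := primitive a H alpha phi s (e r) z (th r).
Let N s r := H (e r) (u s r) (torus_rot alpha s (th r)).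
(* [k] varies the Hamiltonian at a fixed point of the orbit, [v] varies the orbit. *)
Let k s := 'D_(c, 0, d) (uncurry_ham H) (e 0, u s 0, torus_rot alpha s (th 0)).
Let Phi (x : R * R * 'cV[R]_(2 * n) * 'cV[R]_l) := phi x.1.1.1 x.1.1.2 x.1.2 x.2.
Let v s := 'D_(0, c, 0, d) Phi (s, e 0, z, th 0).

Let e0 : e 0 = eps. Proof. by rewrite /e mul0r add0r. Qed.
Let th0 : th 0 = theta. Proof. by rewrite /th scale0r add0r. Qed.

Lemma cvg_e : e @ (0 : R) --> e 0.
Proof.
have h : (fun r : R => r * c) @ (0 : R) --> 0 * c by exact: (@scalel_continuous _ _ c).
exact: (cvgD h (cvg_cst eps)).
Qed.

Lemma cvg_th : th @ (0 : R) --> th 0.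
Proof.
have h : (fun r : R => r *: d) @ (0 : R) --> 0 *: d by exact: scalel_continuous.
exact: (cvgD h (cvg_cst theta)).
Qed.

Section joint_limit.
Context (s0 : R).
Hypothesis Ds0 : D (s0, eps, z, theta).
(* The parameter [r] stays away from [0], where quotients by [r] have no meaning. *)
Let joint := filter_prod (nbhs s0) (dnbhs (0 : R)).
Local Instance joint_filter : Filter joint := filter_prod_filter _ _.

Lemma cvg_joint_time : (fun x : R * R => x.1) @ joint --> s0.
Proof. exact: cvg_fst. Qed.

Lemma cvg_joint_param : (fun x : R * R => x.2) @ joint --> (0 : R).
Proof.
have h : (fun x : R * R => x.2) @ joint --> (0 : R)^' by exact: cvg_snd.
exact: (cvg_trans h (@cvg_within _ _ _ _)).
Qed.

Lemma near_joint_neq0 : \forall x \near joint, x.2 != 0.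
Proof.
have h : (fun x : R * R => x.2) @ joint --> (0 : R)^' by exact: cvg_snd.
have ne : \forall r \near (0 : R)^', r != 0 by exact: nbhs_dnbhs_neq.
exact: (h _ ne).
Qed.

Lemma cvg_joint_e : (fun x : R * R => e x.2) @ joint --> e 0.
Proof. exact: (cvg_comp _ _ cvg_joint_param cvg_e). Qed.

Lemma cvg_joint_th : (fun x : R * R => th x.2) @ joint --> th 0.
Proof. exact: (cvg_comp _ _ cvg_joint_param cvg_th). Qed.

Let D0 : D (s0, e 0, z, th 0). Proof. by rewrite e0 th0. Qed.

Lemma cvg_joint_q :
  (fun x : R * R => (x.1, e x.2, z, th x.2)) @ joint --> (s0, e 0, z, th 0).
Proof.
exact: (cvg_pair (cvg_triple cvg_joint_time cvg_joint_e (cvg_cst z)) cvg_joint_th).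
Qed.

Lemma cvg_joint_q0 :
  (fun x : R * R => (x.1, e 0, z, th 0)) @ joint --> (s0, e 0, z, th 0).
Proof.
exact: (cvg_pair (cvg_triple cvg_joint_time (cvg_cst (e 0)) (cvg_cst z)) (cvg_cst (th 0))).
Qed.

Lemma Phi_continuous : {for (s0, e 0, z, th 0), continuous Phi}.
Proof. by apply: differentiable_continuous; exact: phi_C1.1. Qed.

Lemma cvg_joint_u : (fun x : R * R => u x.1 x.2) @ joint --> u s0 0.
Proof. exact: (cvg_comp _ _ cvg_joint_q Phi_continuous). Qed.

Lemma cvg_joint_u0 : (fun x : R * R => u x.1 0) @ joint --> u s0 0.
Proof. exact: (cvg_comp _ _ cvg_joint_q0 Phi_continuous). Qed.

Lemma cvg_joint_rot (r : R * R -> R) : (fun x => th (r x)) @ joint --> th 0 ->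
  (fun x : R * R => torus_rot alpha x.1 (th (r x))) @ joint --> torus_rot alpha s0 (th 0).
Proof.
move=> h.
have cs : (fun x : R * R => x.1 *: alpha) @ joint --> s0 *: alpha.
  by apply: (cvg_comp _ (fun s => s *: alpha) cvg_joint_time); exact: scalel_continuous.
exact: (cvgD h cs).
Qed.

Lemma cvg_joint_phase :
  (fun x : R * R => (e x.2, u x.1 x.2, torus_rot alpha x.1 (th x.2))) @ joint -->
  (e 0, u s0 0, torus_rot alpha s0 (th 0)).
Proof.
exact: (cvg_triple cvg_joint_e cvg_joint_u (@cvg_joint_rot (fun x => x.2) cvg_joint_th)).
Qed.

Lemma cvg_joint_phase0 :
  (fun x : R * R => (e 0, u x.1 0, torus_rot alpha x.1 (th 0))) @ joint -->
  (e 0, u s0 0, torus_rot alpha s0 (th 0)).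
Proof.
exact: (cvg_triple (cvg_cst (e 0)) cvg_joint_u0 (@cvg_joint_rot (fun=> 0) (cvg_cst (th 0)))).
Qed.

Let Uu : U (u s0 0). Proof. exact: orbit_mem. Qed.

Lemma cvg_joint_X : (fun x : R * R => X x.1 x.2) @ joint --> X s0 0.
Proof.
have cX := continuous_locally_lipschitz
  (@locally_lipschitz_XH _ _ _ _ _ _ U_open a_C2 Omega_unit H_C2
    (e 0, u s0 0, torus_rot alpha s0 (th 0)) Uu).
exact: (cvg_comp _ _ cvg_joint_phase cX).
Qed.

Lemma cvg_joint_X0 : (fun x : R * R => X x.1 0) @ joint --> X s0 0.
Proof.
have cX := continuous_locally_lipschitz
  (@locally_lipschitz_XH _ _ _ _ _ _ U_open a_C2 Omega_unit H_C2
    (e 0, u s0 0, torus_rot alpha s0 (th 0)) Uu).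
exact: (cvg_comp _ _ cvg_joint_phase0 cX).
Qed.

Lemma cvg_joint_k : (fun x : R * R => k x.1) @ joint --> k s0.
Proof.
have ck : {for (e 0, u s0 0, torus_rot alpha s0 (th 0)),
    continuous ('D_(c, 0, d) (uncurry_ham H))}.
  by apply: differentiable_continuous; exact: (H_C2.2 _).1.
exact: (cvg_comp _ _ cvg_joint_phase0 ck).
Qed.

Lemma phase_coords : finite_coords (R * R * 'cV[R]_(2 * n) * 'cV[R]_l)%type.
Proof.
apply: (@finite_coords_prod _ (R * R * 'cV[R]_(2 * n))%type 'cV[R]_l);
  last exact: finite_coords_col.
apply: (@finite_coords_prod _ (R * R)%type 'cV[R]_(2 * n)); last exact: finite_coords_col.
exact: (finite_coords_prod (@finite_coords_line R) (@finite_coords_line R)).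
Qed.

Lemma cvg_joint_du :
  (fun x : R * R => x.2^-1 *: (u x.1 x.2 - u x.1 0)) @ joint --> v s0.
Proof.
apply: cvg_coordinates => i j; rewrite (ord1 j).
have Pi : Ck 1 D (fun x => Phi x i 0) by exact: C1_coord.
have -> : v s0 i 0 = 'D_(0, c, 0, d) (fun x => Phi x i 0) (s0, e 0, z, th 0).
  by rewrite derive_coord//; apply/diff_derivable/phi_C1.1.
have dq : (fun x : R * R => x.2^-1 *:
   ((x.1, e x.2, z, th x.2) - (x.1, e 0, z, th 0))) @ joint --> (0 : R, c, 0 : 'cV[R]_(2 * n), d).
  suff E : \forall x \near joint, x.2^-1 *: ((x.1, e x.2, z, th x.2) - (x.1, e 0, z, th 0)) =
      (0 : R, c, 0 : 'cV[R]_(2 * n), d) by exact: (cvg_near_eq E (cvg_cst _)).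
  apply: filterS near_joint_neq0 => x x0.
  rewrite e0 th0; congr (_, _, _, _); rewrite /=.
  - by rewrite subrr scaler0.
  - by rewrite /e addrK [LHS]mulKf.
  - by rewrite subrr scaler0.
  - by rewrite /th addrK scalerA mulVf// scale1r.
rewrite (_ : (fun _ => _) = fun x : R * R => x.2^-1 *
    (Phi (x.1, e x.2, z, th x.2) i 0 - Phi (x.1, e 0, z, th 0) i 0)).
  exact: (strict_derivative_cvg phase_coords D_open Pi D0 cvg_joint_q0 cvg_joint_q dq).
by apply/funext => x; rewrite !mxE.
Qed.

Lemma cvg_joint_da i :
  (fun x : R * R => x.2^-1 * (a (u x.1 x.2) i 0 - a (u x.1 0) i 0)) @ joint -->
  ('D_(v s0) a (u s0 0)) i 0.
Proof.
have -> : ('D_(v s0) a (u s0 0)) i 0 = 'D_(v s0) (fun w => a w i 0) (u s0 0).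
  by rewrite derive_coord//; apply/diff_derivable/a_C2.1.
exact: (strict_derivative_cvg (@finite_coords_col R (2 * n)) U_open (a_coord_C1 i) Uu
  cvg_joint_u0 cvg_joint_u cvg_joint_du).
Qed.

(** The Hamiltonian varies along the orbits both explicitly, through [k], and
    through the displacement [v] of the orbit. *)
Lemma cvg_joint_dN :
  (fun x : R * R => x.2^-1 * (N x.1 x.2 - N x.1 0)) @ joint -->
  k s0 + 'D_(v s0) (fun w => H (e 0) w (torus_rot alpha s0 (th 0))) (u s0 0).
Proof.
have dH : differentiable (uncurry_ham H) (e 0, u s0 0, torus_rot alpha s0 (th 0)).
  exact: H_C2.1.
have -> : k s0 + 'D_(v s0) (fun w => H (e 0) w (torus_rot alpha s0 (th 0))) (u s0 0) =
    'D_(c, v s0, d) (uncurry_ham H) (e 0, u s0 0, torus_rot alpha s0 (th 0)).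
  rewrite derive_ham_z /k !deriveE// -linearD; congr ('d _ _ _).
  by congr (_, _, _); rewrite /= ?addr0 ?add0r.
have dq : (fun x : R * R => x.2^-1 *: ((e x.2, u x.1 x.2, torus_rot alpha x.1 (th x.2))
     - (e 0, u x.1 0, torus_rot alpha x.1 (th 0)))) @ joint --> (c, v s0, d).
  have T : (fun x : R * R => (c, x.2^-1 *: (u x.1 x.2 - u x.1 0), d)) @ joint --> (c, v s0, d).
    exact: (cvg_triple (cvg_cst c) cvg_joint_du (cvg_cst d)).
  suff E : \forall x \near joint, x.2^-1 *: ((e x.2, u x.1 x.2, torus_rot alpha x.1 (th x.2))
     - (e 0, u x.1 0, torus_rot alpha x.1 (th 0))) = (c, x.2^-1 *: (u x.1 x.2 - u x.1 0), d).
    exact: (cvg_near_eq E T).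
  apply: filterS near_joint_neq0 => x x0.
  congr (_, _, _); rewrite /=.
  - by rewrite e0 /e addrK [LHS]mulKf.
  - by rewrite th0 /th /torus_rot opprD addrACA subrr addr0 addrK scalerA mulVf// scale1r.
have K := @strict_derivative_cvg _ _ _ _ _ _ joint _ _ _ _ _ (@ham_coords R n l)
  (open_ham_domain U_open) ham_C1
  (Uu : ham_domain U (e 0, u s0 0, torus_rot alpha s0 (th 0)))
  cvg_joint_phase0 cvg_joint_phase dq.
exact: K.
Qed.

End joint_limit.

Context (t : R).
Hypothesis Dt : D (t, eps, z, theta).
Let J := `[Num.min 0 t, Num.max 0 t]%classic.
Let int_k s := integral_from0 s k.
Let b s i := (jac a (u s 0) *m X s 0) i 0.
(* [b] is the time derivative of [a] along the orbit, so that [ddefect] is the time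
   derivative of [defect]; no derivative of [u] in the parameter occurs in it. *)
Let defect s r := p s r - \sum_i a (u s 0) i 0 * (u s r i 0 - u s 0 i 0) + r * int_k s.
Let ddefect s r := lagrangian (e r) z (th r) s
  - \sum_i (b s i * (u s r i 0 - u s 0 i 0) + a (u s 0) i 0 * (X s r i 0 - X s 0 i 0)) + r * k s.

Let J0 : J 0. Proof. by rewrite /J /= in_itv/= ge_min le_max lexx. Qed.
Let Jt : J t. Proof. by rewrite /J /= in_itv/= ge_min le_max lexx !orbT. Qed.

Lemma domain_segment e' th' s : D (t, e', z, th') -> J s -> D (s, e', z, th').
Proof.
move=> Dt'; rewrite /J /= in_itv/= => sJ.
have Ii : is_interval [set s | D (s, e', z, th')] by exact: orbit_interval.
have I0 : D (0, e', z, th') by exact: orbit_domain0.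
have := sJ; case: (leP 0 t) => _ {}sJ; first exact: (Ii 0 t).
exact: (Ii t 0).
Qed.

Lemma near_domain : \forall r \near (0 : R), D (t, e r, z, th r).
Proof.
have q : (fun r : R => (t, e r, z, th r)) @ (0 : R) --> (t, e 0, z, th 0).
  exact: (cvg_pair (cvg_triple (cvg_cst t) cvg_e (cvg_cst z)) cvg_th).
have nD : nbhs (t, e 0, z, th 0) D.
  by apply: open_nbhs_nbhs; split => //; rewrite e0 th0.
exact: (q _ nD).
Qed.

Lemma is_derive_int_k s : J s -> is_derive s 1 int_k (k s).
Proof.
move=> Js; have Is := domain_segment Dt Js.
have Ds' : D (s, e 0, z, th 0) by rewrite e0 th0.
apply: (@is_derive_integral_from0 _ [set s | D (s, e 0, z, th 0)]) => //;
  [exact: orbit_interval|exact: orbit_open|exact: orbit_domain0|move=> s1 Ds1].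
apply: (cvg_orbit_ham Uz Ds1 (f := 'D_(c, 0, d) (uncurry_ham H))) => x Ux.
by apply: differentiable_continuous; exact: (H_C2.2 _).1.
Qed.

Lemma is_derive_coord (f : R -> 'cV[R]_(2 * n)) (s : R) df i :
  is_derive s 1 f df -> is_derive s 1 (fun s => f s i 0) (df i 0).
Proof.
move=> [f1 <-]; split; last exact: derive_coord.
by move/derivable_mxP : f1; exact.
Qed.

Lemma is_derive_a_orbit s i : J s -> is_derive s 1 (fun s => a (u s 0) i 0) (b s i).
Proof.
move=> Js; have Ds0 : D (s, e 0, z, th 0) by rewrite e0 th0; exact: domain_segment Dt Js.
have Us := orbit_mem Uz Ds0.
have -> : b s i = 'D_(X s 0) (fun w => a w i 0) (u s 0).
  rewrite /b -derive_jac// derive_coord//; apply/diff_derivable.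
  exact: a_C2.1.
apply: (is_derive_C1_comp (@finite_coords_col R (2 * n)) U_open (a_coord_C1 i) Us).
exact: is_derive_orbit.
Qed.

Lemma is_derive_defect r s : D (t, e r, z, th r) -> J s -> is_derive s 1 (defect^~ r) (ddefect s r).
Proof.
move=> Dr Js; have Dsr := domain_segment Dr Js.
have Ds0 : D (s, e 0, z, th 0) by rewrite e0 th0; exact: domain_segment Dt Js.
have dp : is_derive s 1 (p^~ r) (lagrangian (e r) z (th r) s) by exact: is_derive_primitive.
have dh := is_derive_int_k Js.
have du i : is_derive s 1 (fun s => u s r i 0 - u s 0 i 0) (X s r i 0 - X s 0 i 0).
  apply: is_deriveB; first exact: (is_derive_coord i (is_derive_orbit Uz Dsr)).
  exact: (is_derive_coord i (is_derive_orbit Uz Ds0)).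
have dau i : is_derive s 1 (fun s => a (u s 0) i 0 * (u s r i 0 - u s 0 i 0))
    (b s i * (u s r i 0 - u s 0 i 0) + a (u s 0) i 0 * (X s r i 0 - X s 0 i 0)).
  have da := is_derive_a_orbit i Js.
  have dm := is_deriveM da (du i).
  apply: (is_derive_eq dm); rewrite addrC /= /GRing.scale /=.
  by congr (_ + _); rewrite mulrC.
have ds := is_derive_sum (fun i => dau i).
have dr : is_derive s 1 (fun s => r * int_k s) (r * k s) by exact: is_deriveZ.
have -> : defect^~ r = (fun s => p s r
    - (\sum_i (fun s => a (u s 0) i 0 * (u s r i 0 - u s 0 i 0))) s
    + r * int_k s).
  by apply/funext => s1; rewrite fct_sumE.
exact: (is_deriveD (is_deriveB dp ds) dr).
Qed.

(** In the limit, the increments of [a], of [H] and of the orbit give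
    [(Da v) . X], [k + D_z H v] and [(Da X) . v]; [moment_identity] says that they
    cancel, up to the term [k], which the derivative of [int_k] compensates. The
    increment of [X] drops out before dividing by [r], so that
    continuity of [X] is enough. *)
Lemma cvg_ddefect_quotient (s0 : R) : J s0 ->
  (fun x : R * R => x.2^-1 * (ddefect x.1 x.2 - ddefect x.1 0))
    @ filter_prod (nbhs s0) (dnbhs (0 : R)) --> (0 : R).
Proof.
move=> Js0; have Ds0 := domain_segment Dt Js0.
set joint := filter_prod _ _.
have FF : Filter joint by exact: filter_prod_filter.
have Ds0' : D (s0, e 0, z, th 0) by rewrite e0 th0.
have Us := orbit_mem Uz Ds0'.
have cX i : (fun x : R * R => X x.1 x.2 i 0) @ joint --> X s0 0 i 0.
  exact: (cvg_comp _ _ (cvg_joint_X Ds0) (@coord_continuous _ _ _ i 0 _)).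
have cX0 i : (fun x : R * R => X x.1 0 i 0) @ joint --> X s0 0 i 0.
  exact: (cvg_comp _ _ (cvg_joint_X0 Ds0) (@coord_continuous _ _ _ i 0 _)).
have cdu i : (fun x : R * R => (x.2^-1 *: (u x.1 x.2 - u x.1 0)) i 0) @ joint --> v s0 i 0.
  exact: (cvg_comp _ _ (cvg_joint_du Ds0) (@coord_continuous _ _ _ i 0 _)).
have cb i : (fun x : R * R => b x.1 i) @ joint --> b s0 i.
  have bE s : b s i = \sum_j jac a (u s 0) i j * X s 0 j 0 by rewrite /b mxE.
  rewrite bE (_ : (fun x : R * R => b x.1 i) =
    fun x => \sum_j jac a (u x.1 0) i j * X x.1 0 j 0); last exact/funext.
  apply: (@cvg_sum _ _ joint _ _ (fun j (x : R * R) => jac a (u x.1 0) i j * X x.1 0 j 0)) => j.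
  apply: cvgM; last exact: cX0.
  have -> : (fun x : R * R => jac a (u x.1 0) i j) =
      (fun x : R * R => ('D_(delta_mx j 0) a (u x.1 0)) i 0).
    by apply/funext => x; rewrite mxE.
  rewrite [jac a _ i j]mxE.
  have cD : {for u s0 0, continuous ('D_(delta_mx j 0) a)}.
    by apply: differentiable_continuous; exact: (a_C2.2 _).1.
  have cD1 := cvg_comp _ _ (cvg_joint_u0 Ds0) cD.
  exact: (cvg_comp _ _ cD1 (@coord_continuous _ _ _ i 0 _)).
have lim1 : (fun x : R * R =>
    \sum_i (x.2^-1 * (a (u x.1 x.2) i 0 - a (u x.1 0) i 0)) * X x.1 x.2 i 0)
    @ joint --> \sum_i ('D_(v s0) a (u s0 0)) i 0 * X s0 0 i 0.
  apply: (@cvg_sum _ _ joint _ _ (fun i (x : R * R) =>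
    (x.2^-1 * (a (u x.1 x.2) i 0 - a (u x.1 0) i 0)) * X x.1 x.2 i 0)) => i.
  by apply: cvgM; [exact: cvg_joint_da|exact: cX].
have lim2 : (fun x : R * R => \sum_i b x.1 i * (x.2^-1 *: (u x.1 x.2 - u x.1 0)) i 0)
    @ joint --> \sum_i b s0 i * v s0 i 0.
  apply: (@cvg_sum _ _ joint _ _ (fun i (x : R * R) =>
    b x.1 i * (x.2^-1 *: (u x.1 x.2 - u x.1 0)) i 0)) => i.
  by apply: cvgM; [exact: cb|exact: cdu].
have lim : (fun x : R * R =>
    \sum_i (x.2^-1 * (a (u x.1 x.2) i 0 - a (u x.1 0) i 0)) * X x.1 x.2 i 0
    - x.2^-1 * (N x.1 x.2 - N x.1 0)
    - \sum_i b x.1 i * (x.2^-1 *: (u x.1 x.2 - u x.1 0)) i 0 + k x.1) @ joint -->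
   \sum_i ('D_(v s0) a (u s0 0)) i 0 * X s0 0 i 0
   - (k s0 + 'D_(v s0) (fun w => H (e 0) w (torus_rot alpha s0 (th 0))) (u s0 0))
   - \sum_i b s0 i * v s0 i 0 + k s0.
  exact: (cvgD (cvgB (cvgB lim1 (cvg_joint_dN Ds0)) lim2) (cvg_joint_k Ds0)).
(* This is where the equation [Omega X = grad H] enters. *)
have E0 : \sum_i ('D_(v s0) a (u s0 0)) i 0 * X s0 0 i 0
   - (k s0 + 'D_(v s0) (fun w => H (e 0) w (torus_rot alpha s0 (th 0))) (u s0 0))
   - \sum_i b s0 i * v s0 i 0 + k s0 = 0.
  have := moment_identity (e 0) (torus_rot alpha s0 (th 0)) (v s0) Us.
  rewrite -/(X s0 0) => <-.
  by rewrite /b; ring.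
rewrite E0 in lim.
suff E : \forall x \near joint, x.2^-1 * (ddefect x.1 x.2 - ddefect x.1 0) =
    \sum_i (x.2^-1 * (a (u x.1 x.2) i 0 - a (u x.1 0) i 0)) * X x.1 x.2 i 0
    - x.2^-1 * (N x.1 x.2 - N x.1 0)
    - \sum_i b x.1 i * (x.2^-1 *: (u x.1 x.2 - u x.1 0)) i 0 + k x.1.
  exact: (cvg_near_eq E lim).
apply: filterS (near_joint_neq0 s0) => -[s r] /= r0.
have ddefectE : ddefect s r = \sum_i a (u s r) i 0 * X s r i 0 - N s r
    - \sum_i (b s i * (u s r i 0 - u s 0 i 0) + a (u s 0) i 0 * (X s r i 0 - X s 0 i 0))
    + r * k s.
  by rewrite /ddefect lagrangianE.
have ddefect0E : ddefect s 0 = \sum_i a (u s 0) i 0 * X s 0 i 0 - N s 0.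
  rewrite /ddefect lagrangianE mul0r addr0 [X in _ - X]big1 ?subr0//.
  by move=> i _; rewrite !subrr !mulr0 addr0.
have qE i : (r^-1 *: (u s r - u s 0)) i 0 = r^-1 * (u s r i 0 - u s 0 i 0).
  by rewrite !mxE.
rewrite ddefectE ddefect0E (difference_quotient_split
  (fun i => a (u s r) i 0) (fun i => a (u s 0) i 0)
  (fun i => X s r i 0) (fun i => X s 0 i 0) (fun i => u s r i 0) (fun i => u s 0 i 0)
  (fun i => b s i) (N s r) (N s 0) (k s) r0).
by congr (_ - _ + _); apply: eq_bigr => i _; rewrite qE.
Qed.

Lemma cvg_primitive_variation :
  (fun r => r^-1 * (p t r - p t 0)) @ (0 : R)^' --> \sum_i a (u t 0) i 0 * v t i 0 - int_k t.
Proof.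
have cdef : (fun r => r^-1 * (defect t r - defect t 0)) @ 0^' --> (0 : R).
  apply: (@quotient_antiderivative_cvg0 R J defect ddefect) => //.
  - exact: interval_is_interval.
  - exact: segment_compact.
  - near=> r; rewrite /defect /p primitive0 /int_k integral_from0_0 mulr0 addr0 sub0r.
    rewrite big1 ?oppr0// => i _.
    by rewrite /u !orbit0// subrr mulr0.
  - near=> r; move=> s Js; apply: is_derive_defect => //; near: r; exact: near_domain.
  - exact: cvg_ddefect_quotient.
have cduv : (fun r => r^-1 *: (u t r - u t 0)) @ (0 : R)^' --> v t.
  have cpair : (fun r : R => (t, r)) @ (0 : R)^' --> filter_prod (nbhs t) (dnbhs (0 : R)).
    exact: (cvg_pair (cvg_cst t) cvg_id).
  exact: (cvg_comp _ _ cpair (cvg_joint_du Dt)).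
have lim1 : (fun r => \sum_i a (u t 0) i 0 * (r^-1 *: (u t r - u t 0)) i 0) @ (0 : R)^' -->
    \sum_i a (u t 0) i 0 * v t i 0.
  apply: (@cvg_sum _ _ (0 : R)^' _ _ (fun i r =>
    a (u t 0) i 0 * (r^-1 *: (u t r - u t 0)) i 0)) => i.
  apply: cvgM; first exact: cvg_cst.
  exact: (cvg_comp _ _ cduv (@coord_continuous _ _ _ i 0 _)).
have lim : (fun r => r^-1 * (defect t r - defect t 0) +
    \sum_i a (u t 0) i 0 * (r^-1 *: (u t r - u t 0)) i 0 - int_k t) @ (0 : R)^' -->
    0 + \sum_i a (u t 0) i 0 * v t i 0 - int_k t.
  exact: (cvgB (cvgD cdef lim1) (cvg_cst (int_k t))).
rewrite add0r in lim.
suff E : \forall r \near (0 : R)^', r^-1 * (p t r - p t 0) = r^-1 * (defect t r - defect t 0) +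
    \sum_i a (u t 0) i 0 * (r^-1 *: (u t r - u t 0)) i 0 - int_k t.
  exact: (cvg_near_eq E lim).
near=> r.
have r0 : r != 0 by near: r; exact: nbhs_dnbhs_neq.
have -> : \sum_i a (u t 0) i 0 * (r^-1 *: (u t r - u t 0)) i 0 =
    r^-1 * \sum_i a (u t 0) i 0 * (u t r i 0 - u t 0 i 0).
  by rewrite mulr_sumr; apply: eq_bigr => i _; rewrite !mxE mulrCA.
have defect0E : defect t 0 = p t 0.
  by rewrite /defect mul0r addr0 big1 ?subr0// => i _; rewrite subrr mulr0.
rewrite defect0E /defect; move: (p t r) (p t 0) (int_k t) (\sum_i _) => p1 p0 ht S.
by field.
Unshelve. all: by end_near. Qed.

End variation.
End evolution.

(** * The moment map of the evolution operator *)

Lemma par_tE {R : realType} l (t e : R) (th : 'cV[R]_l) : par_t (par t e th) = t.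
Proof. by rewrite /par_t /par col_mxKu col_mxKu mxE mulr1n. Qed.

Lemma par_epsE {R : realType} l (t e : R) (th : 'cV[R]_l) : par_eps (par t e th) = e.
Proof. by rewrite /par_eps /par col_mxKu col_mxKd mxE mulr1n. Qed.

Lemma par_thetaE {R : realType} l (t e : R) (th : 'cV[R]_l) : par_theta (par t e th) = th.
Proof. by rewrite /par_theta /par col_mxKd. Qed.

Lemma par_eta {R : realType} l (bt : 'cV[R]_(1 + 1 + l)) :
  par (par_t bt) (par_eps bt) (par_theta bt) = bt.
Proof. by rewrite /par /par_t /par_eps /par_theta -!mx11_scalar !vsubmxK. Qed.

Lemma scale_add_par {R : realType} l (h t e c0 c : R) (th d : 'cV[R]_l) :
  h *: par c0 c d + par t e th = par (h * c0 + t) (h * c + e) (h *: d + th).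
Proof. by rewrite /par !scale_col_mx !add_col_mx !scale_scalar_mx -!raddfD. Qed.

Lemma tau_rot_inj {R : realType} l (alpha : 'cV[R]_l) : injective (tau_rot alpha).
Proof.
move=> b1 b2 E.
have Et : par_t b1 = par_t b2.
  by have := congr1 (@par_t R l) E; rewrite !par_tE.
have Ee : par_eps b1 = par_eps b2.
  by have := congr1 (@par_eps R l) E; rewrite !par_epsE.
have Eth : par_theta b1 = par_theta b2.
  have := congr1 (@par_theta R l) E; rewrite !par_thetaE Et.
  exact: addIr.
by rewrite -(par_eta b1) -(par_eta b2) Et Ee Eth.
Qed.

Lemma delta_par_t {R : realType} l :
  delta_mx (lshift l (lshift 1 0)) 0 = par 1 0 0 :> 'cV[R]_(1 + 1 + l).
Proof.
apply/colP => i; rewrite /par !mxE.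
case: splitP => j ij; rewrite !mxE.
  by case: splitP => k jk; rewrite !mxE -val_eqE /= ij jk !ord1 /= ?mulr1n ?mul0rn.
by rewrite -val_eqE /= ij.
Qed.

Lemma delta_par_eps {R : realType} l :
  delta_mx (lshift l (rshift 1 0)) 0 = par 0 1 0 :> 'cV[R]_(1 + 1 + l).
Proof.
apply/colP => i; rewrite /par !mxE.
case: splitP => j ij; rewrite !mxE.
  by case: splitP => k jk; rewrite !mxE -val_eqE /= ij jk !ord1 /= ?mulr1n ?mul0rn.
by rewrite -val_eqE /= ij.
Qed.

Lemma delta_par_theta {R : realType} l (m : 'I_l) :
  delta_mx (rshift (1 + 1) m) 0 = par 0 0 (delta_mx m 0) :> 'cV[R]_(1 + 1 + l).
Proof.
apply/colP => i; rewrite /par !mxE.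
case: splitP => j ij; rewrite !mxE.
  by case: splitP => k jk; rewrite !mxE -val_eqE /= ij jk !ord1 /= ?mulr1n ?mul0rn.
by rewrite -!val_eqE /= ij eqn_add2l.
Qed.

(** The Jacobians in the definition of the moment map are taken in the stacked
    parameter [(t, eps, theta)]; this unstacks their difference quotients. *)
Lemma derive_with_par {R : realType} n l (V : normedModType R)
    (f : R -> R -> 'cV[R]_(2 * n) -> 'cV[R]_l -> V) z t e th c0 c d :
  'D_(par c0 c d) (with_par f z) (par t e th) =
  lim ((fun h => h^-1 *: (f (h * c0 + t) (h * c + e) z (h *: d + th) - f t e z th)) @ 0^').
Proof.
have E : (fun h : R => h^-1 *: (((with_par f z) \o shift (par t e th)) (h *: par c0 c d)
    - with_par f z (par t e th))) =
  (fun h => h^-1 *: (f (h * c0 + t) (h * c + e) z (h *: d + th) - f t e z th)).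
  apply/funext => h; rewrite /= scale_add_par /with_par.
  by rewrite !par_tE !par_epsE !par_thetaE.
by rewrite /derive E.
Qed.

Section moment_map.
Context {R : realType} {n l : nat} (U : set 'cV[R]_(2 * n)).
Context (a : 'cV[R]_(2 * n) -> 'cV[R]_(2 * n)) (alpha : 'cV[R]_l).
Context (H : R -> 'cV[R]_(2 * n) -> 'cV[R]_l -> R).
Context (D : set (R * R * 'cV[R]_(2 * n) * 'cV[R]_l)).
Context (phi : R -> R -> 'cV[R]_(2 * n) -> 'cV[R]_l -> 'cV[R]_(2 * n)).
Hypothesis U_open : open U.
Hypothesis a_C2 : Ck 2 U a.
Hypothesis Omega_unit : forall z, U z -> Omega a z \in unitmx.
Hypothesis H_C2 : Ck 2 (ham_domain U) (uncurry_ham H).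
Hypothesis phi_evol : evolution_operator U (XH a H) alpha D phi.
Hypothesis D_open : open D.
Hypothesis phi_C1 : Ck 1 D (fun x => phi x.1.1.1 x.1.1.2 x.1.2 x.2).

(** Uniqueness of solutions is applied backwards, from time [t] to time [0]. *)
Lemma evolution_injective t e th z1 z2 :
  D (t, e, z1, th) -> D (t, e, z2, th) -> phi t e z1 th = phi t e z2 th -> z1 = z2.
Proof.
move=> D1 D2 E.
have U1 := phi_evol.1 _ _ _ _ D1; have U2 := phi_evol.1 _ _ _ _ D2.
pose I := [set s | D (s, e, z1, th)] `&` [set s | D (s, e, z2, th)].
have Ii : is_interval I.
  move=> x y [x1 x2] [y1 y2] s xsy.
  by split; [exact: (orbit_interval phi_evol U1 x1 y1)|exact: (orbit_interval phi_evol U2 x2 y2)].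
have Io : open I by apply: openI; [exact: (orbit_open phi_evol U1)|exact: (orbit_open phi_evol U2)].
have I0 : I 0.
  by split; [exact: (orbit_domain0 phi_evol e th U1)|exact: (orbit_domain0 phi_evol e th U2)].
rewrite -(orbit0 phi_evol e th U1) -(orbit0 phi_evol e th U2).
apply: (@solution_unique _ _ _ U a H U_open a_C2 Omega_unit H_C2 alpha e th I
  (fun s => phi s e z1 th) (fun s => phi s e z2 th) t) => //.
- move=> s [s1 _]; split; first exact: (orbit_mem phi_evol U1).
  exact: (is_derive_orbit phi_evol U1).
- move=> s [_ s2]; split; first exact: (orbit_mem phi_evol U2).
  exact: (is_derive_orbit phi_evol U2).
Qed.

Context (t eps : R) (z : 'cV[R]_(2 * n)) (theta : 'cV[R]_l).
Hypothesis Dt : D (t, eps, z, theta).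
Let w := phi t eps z theta.
Let M := evolution_moment_map a H alpha D phi w (tau_rot alpha (par t eps theta)).
Let p := primitive a H alpha phi.

(** Both formal inverses cancel: the shift of the parameters is injective on the
    whole space, and the fibre map is injective on its domain. What remains is the
    moment map evaluated along the deformation. *)
Lemma moment_map_coord j : M j 0 =
  \sum_i a w i 0 * ('D_(delta_mx j 0) (with_par phi z) (par t eps theta)) i 0
  - 'D_(delta_mx j 0) (with_par p z) (par t eps theta).
Proof.
have bsE : param_inv (tau_rot alpha) (tau_rot alpha (par t eps theta)) = par t eps theta.
  apply: pinvKV; last by rewrite inE.
  by move=> ? ? _ _; exact: tau_rot_inj.
have zE : fibre_inv [set x | D (par_t x.2, par_eps x.2, x.1, par_theta x.2)] (with_par phi)
    (par t eps theta) w = z.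
  have -> : w = with_par phi z (par t eps theta).
    by rewrite /with_par par_tE par_epsE par_thetaE.
  apply: (@pinvKV _ _ _ _ (with_par phi ^~ (par t eps theta))).
    move=> z1 z2; rewrite !inE /= /with_par par_tE par_epsE par_thetaE.
    exact: evolution_injective.
  by rewrite inE /= par_tE par_epsE par_thetaE.
rewrite /M /evolution_moment_map /moment_map /deformation_generator bsE zE.
rewrite [LHS]mxE [LHS]mxE; congr (_ + _); last by rewrite [LHS]mxE [in LHS]mxE.
by rewrite [LHS]mxE; apply: eq_bigr => i _; rewrite [X in X * _]mxE [X in _ * X]mxE.
Qed.

Let Uz : U z := phi_evol.1 _ _ _ _ Dt.

Lemma moment_map_t : par_t M = H eps w (torus_rot alpha t theta).
Proof.
have -> : par_t M = M (lshift l (lshift 1 0)) 0 by rewrite /par_t !mxE.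
rewrite moment_map_coord delta_par_t.
have E (V : normedModType R) (f : R -> R -> 'cV[R]_(2 * n) -> 'cV[R]_l -> V) :
    'D_(par 1 0 0) (with_par f z) (par t eps theta) = 'D_1 (fun s => f s eps z theta) t.
  have Eq : (fun h : R => h^-1 *: (f (h * 1 + t) (h * 0 + eps) z (h *: 0 + theta)
      - f t eps z theta)) =
     (fun h => h^-1 *: (((fun s => f s eps z theta) \o shift t) (h *: (1 : R)) - f t eps z theta)).
    by apply/funext => h; rewrite /= mulr0 scaler0 !add0r.
  by rewrite derive_with_par Eq.
have [_ Dphi] := is_derive_orbit phi_evol Uz Dt.
have [_ Dp] := is_derive_primitive U_open a_C2 Omega_unit H_C2 phi_evol Uz Dt.
by rewrite !E Dphi Dp lagrangianE opprB addrCA subrr addr0.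
Qed.

(** The contribution of the displacement of the orbit is the same in
    [a(phi) . D phi] and in [D p], and disappears from the difference. *)
Lemma moment_map_param (c : R) (d : 'cV[R]_l) j :
  delta_mx j 0 = par 0 c d ->
  M j 0 = integral_from0 t (fun s => 'D_(c, 0, d) (uncurry_ham H)
     (eps, phi s eps z theta, torus_rot alpha s theta)).
Proof.
move=> jE; rewrite moment_map_coord jE.
have var := @cvg_primitive_variation _ _ _ U a alpha H D phi U_open a_C2 Omega_unit H_C2
  phi_evol D_open phi_C1 eps c z theta d Uz t Dt.
rewrite mul0r scale0r !add0r in var.
have -> : 'D_(par 0 c d) (with_par p z) (par t eps theta) =
    \sum_i a w i 0 * ('D_(0, c, 0, d) (fun x : R * R * 'cV[R]_(2 * n) * 'cV[R]_l =>
       phi x.1.1.1 x.1.1.2 x.1.2 x.2) (t, eps, z, theta)) i 0 -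
    integral_from0 t (fun s => 'D_(c, 0, d) (uncurry_ham H)
     (eps, phi s eps z theta, torus_rot alpha s theta)).
  have Eq : (fun h : R => h^-1 *: (p (h * 0 + t) (h * c + eps) z (h *: d + theta)
      - p t eps z theta)) =
     (fun r => r^-1 * (p t (r * c + eps) z (r *: d + theta) - p t eps z theta)).
    by apply/funext => h; rewrite mulr0 add0r.
  by rewrite derive_with_par Eq; exact: (cvg_lim _ var).
have -> : 'D_(par 0 c d) (with_par phi z) (par t eps theta) =
  'D_(0, c, 0, d) (fun x : R * R * 'cV[R]_(2 * n) * 'cV[R]_l =>
       phi x.1.1.1 x.1.1.2 x.1.2 x.2) (t, eps, z, theta).
  have Eq : (fun h : R => h^-1 *: (phi (h * 0 + t) (h * c + eps) z (h *: d + theta)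
      - phi t eps z theta)) =
     (fun h => h^-1 *: (((fun x : R * R * 'cV[R]_(2 * n) * 'cV[R]_l =>
       phi x.1.1.1 x.1.1.2 x.1.2 x.2) \o shift (t, eps, z, theta)) (h *: (0, c, 0, d))
       - phi t eps z theta)).
    by apply/funext => h; rewrite /= !scaler0 mulr0 !add0r.
  by rewrite derive_with_par Eq.
by rewrite subKr.
Qed.

End moment_map.

Lemma derive_ham_eps {R : realType} n l (H : R -> 'cV[R]_(2 * n) -> 'cV[R]_l -> R) e w th :
  'D_(1, 0, 0) (uncurry_ham H) (e, w, th) = derive1 (fun e => H e w th) e.
Proof.
have E : (fun h : R => h^-1 *: ((uncurry_ham H \o shift (e, w, th)) (h *: (1, 0, 0))
      - uncurry_ham H (e, w, th))) =
  (fun h => h^-1 *: (((fun e => H e w th) \o shift e) (h *: (1 : R)) - H e w th)).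
  by apply/funext => h; rewrite /uncurry_ham /= !scaler0 !add0r.
by rewrite derive1E /derive E.
Qed.

Lemma derive_ham_theta {R : realType} n l (H : R -> 'cV[R]_(2 * n) -> 'cV[R]_l -> R) e w th d :
  'D_(0, 0, d) (uncurry_ham H) (e, w, th) = 'D_d (H e w) th.
Proof.
have E : (fun h : R => h^-1 *: ((uncurry_ham H \o shift (e, w, th)) (h *: (0, 0, d))
      - uncurry_ham H (e, w, th))) =
  (fun h => h^-1 *: ((H e w \o shift th) (h *: d) - H e w th)).
  by apply/funext => h; rewrite /uncurry_ham /= !scaler0 !add0r.
by rewrite /derive E.
Qed.

Theorem lemmaE2 (R : realType) (n l : nat)
  (U : set 'cV[R]_(2 * n))
  (a : 'cV[R]_(2 * n) -> 'cV[R]_(2 * n))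
  (alpha : 'cV[R]_l)
  (H : R -> 'cV[R]_(2 * n) -> 'cV[R]_l -> R)
  (D : set (R * R * 'cV[R]_(2 * n) * 'cV[R]_l))
  (phi : R -> R -> 'cV[R]_(2 * n) -> 'cV[R]_l -> 'cV[R]_(2 * n))
  (U_open : open U)
  (a_C2 : Ck 2 U a)
  (Omega_unit : forall z, U z -> Omega a z \in unitmx)
  (H_C2 : Ck 2 [set x : R * 'cV[R]_(2 * n) * 'cV[R]_l | U x.1.2]
                (fun x => H x.1.1 x.1.2 x.2))
  (H_periodic : periodic_on U H)
  (phi_evol : evolution_operator U (XH a H) alpha D phi)
  (D_open : open D)
  (phi_C1 : Ck 1 D (fun x => phi x.1.1.1 x.1.1.2 x.1.2 x.2))
  (t eps : R) (z : 'cV[R]_(2 * n)) (theta : 'cV[R]_l)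
  (Dtz : D (t, eps, z, theta)) :
  let M := evolution_moment_map a H alpha D phi
             (phi t eps z theta) (tau_rot alpha (par t eps theta)) in
  [/\ par_t M = H eps (phi t eps z theta) (torus_rot alpha t theta),
      par_eps M =
        integral_from0 t (fun s =>
          derive1 (fun e => H e (phi s eps z theta) (torus_rot alpha s theta)) eps) &
      (par_theta M)^T =
        integral_from0_row t (fun s =>
          grad (H eps (phi s eps z theta)) (torus_rot alpha s theta))].
Proof.
move=> M.
have param := moment_map_param U_open a_C2 Omega_unit H_C2 phi_evol D_open phi_C1 Dtz.
split.
- exact: (moment_map_t U_open a_C2 Omega_unit H_C2 phi_evol Dtz).
- have -> : par_eps M = M (lshift l (rshift 1 0)) 0 by rewrite /par_eps !mxE.
  rewrite (param _ _ _ (delta_par_eps l)); congr (integral_from0 t _).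
  by apply/funext => s; exact: derive_ham_eps.
- apply/rowP => j.
  have -> : (par_theta M)^T 0 j = M (rshift (1 + 1) j) 0 by rewrite /par_theta !mxE.
  rewrite (param _ _ _ (delta_par_theta j)) mxE; congr (integral_from0 t _).
  by apply/funext => s; rewrite mxE; exact: derive_ham_theta.
Qed.
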